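(* Let $F:(M,g_M)\to(N,g_N)$ be a Clairaut Riemannian map with $s=e^{f}$ between Riemannian manifolds, such that $(\mathrm{range}\,F_\ast)^\perp$ is totally geodesic. Then the Ricci equation of $F$ is $$[S_W,S_V]F_\ast X=0$$ for all $X\in\Gamma((\ker F_\ast)^\perp)$ and all $V,W\in\Gamma((\mathrm{range}\,F_\ast)^\perp)$.
   Context: $\nabla^M,\nabla^N$ are the Levi-Civita connections and $\Gamma(\cdot)$ denotes sections. $F:M\to N$ is smooth with $0<\mathrm{rank}\,F<\min\{\dim M,\dim N\}$; $(\ker F_\ast)^\perp\subset TM$ is the orthogonal complement of $\ker F_\ast$, and $(\mathrm{range}\,F_\ast)^\perp\subset TN$ is the orthogonal complement of $\mathrm{range}\,F_\ast$; $\mathrm{range}\,F_\ast$ and $(\mathrm{range}\,F_\ast)^\perp$ are regarded as complementary orthogonal distributions on $N$. $F$ is a Riemannian map if $g_N(F_\ast X,F_\ast Y)=g_M(X,Y)$ for all $X,Y\in\Gamma((\ker F_\ast)^\perp)$. For $V\in\Gamma((\mathrm{range}\,F_\ast)^\perp)$ write $\nabla^N_{F_\ast X}V=-S_VF_\ast X+\nabla^{F\perp}_XV$, where $-S_VF_\ast X$ is the component in $\mathrm{range}\,F_\ast$ and $\nabla^{F\perp}_XV$ the component in $(\mathrm{range}\,F_\ast)^\perp$. $[S_W,S_V]=S_WS_V-S_VS_W$. $(\mathrm{range}\,F_\ast)^\perp$ is totally geodesic if $\nabla^N_UV\in\Gamma((\mathrm{range}\,F_\ast)^\perp)$ for all $U,V\in\Gamma((\mathrm{range}\,F_\ast)^\perp)$.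 A Riemannian map $F$ is a Clairaut Riemannian map if there is a function $s:N\to\mathbb R^+$ such that for every geodesic $\beta$ on $N$ the function $(s\circ\beta)\sin\theta(t)$ is constant, where $F_\ast X\in\Gamma(\mathrm{range}\,F_\ast)$ and $V\in\Gamma((\mathrm{range}\,F_\ast)^\perp)$ are the components of $\dot\beta(t)$ and $\theta(t)$ is the angle between $\dot\beta(t)$ and $V$. ''With $s=e^f$'' means that $s=e^f$ for a smooth function $f$ on $N$. *)

(* Defs.v *)
From HB Require Import structures.
From mathcomp Require Import all_boot all_order all_algebra.
From mathcomp Require Import all_classical all_reals all_analysis.
Set Implicit Arguments.
Unset Strict Implicit.
Unset Printing Implicit Defensive.
Import Order.TTheory GRing.Theory Num.Theory.
Import numFieldNormedType.Exports.
Local Open Scope classical_set_scope.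
Local Open Scope ring_scope.

(* Only meaningful for [U] open. *)
Fixpoint Ck_on (R : realType) (n k : nat) (U : set 'rV[R]_n)
    (f : 'rV[R]_n -> R) : Prop :=
  match k with
  | 0 => forall x, U x -> {for x, continuous f}
  | k'.+1 => (forall x, U x -> differentiable f x) /\
      (forall i : 'I_n, Ck_on k' U (fun x => 'D_(delta_mx 0 i) f x))
  end.

Definition smooth_on (R : realType) (n : nat) (U : set 'rV[R]_n)
  (f : 'rV[R]_n -> R) : Prop := forall k, Ck_on k U f.

Definition smooth_vec_on (R : realType) (n n' : nat) (U : set 'rV[R]_n)
    (f : 'rV[R]_n -> 'rV[R]_n') : Prop :=
  forall a : 'I_n', smooth_on U (fun x => f x 0 a).

(* [chart i] is a homeomorphism from [chart_dom i] onto an open subset of R^n,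
   with inverse [chart_inv i]; both are total functions with irrelevant values
   outside these sets.  [chart_at p] is a chosen chart around [p]; it only
   serves to represent tangent vectors (see [in_chart]). *)
Record manifold (R : realType) (n : nat) := Manifold {
  carrier :> topologicalType;
  carrier_hausdorff : hausdorff_space carrier;
  carrier_second_countable : @second_countable carrier;
  chart_index : Type;
  chart_dom : chart_index -> set carrier;
  chart : chart_index -> carrier -> 'rV[R]_n;
  chart_inv : chart_index -> 'rV[R]_n -> carrier;
  chart_dom_open : forall i, open (chart_dom i);
  chart_img_open : forall i, open (chart i @` chart_dom i);
  chartK : forall i p, chart_dom i p -> chart_inv i (chart i p) = p;
  chart_continuous : forall i p, chart_dom i p ->
    {for p, continuous (chart i)};
  chart_inv_continuous : forall i x, (chart i @` chart_dom i) x ->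
    {for x, continuous (chart_inv i)};
  transition_smooth : forall i j,
    smooth_vec_on (chart i @` (chart_dom i `&` chart_dom j))
      (chart j \o chart_inv i);
  chart_at : carrier -> chart_index;
  chart_at_dom : forall p, chart_dom (chart_at p) p
}.

Section Manifold.
Variables (R : realType) (n : nat) (N : manifold R n).
Implicit Types (i : chart_index N) (p q : N) (v w : 'rV[R]_n)
  (X Y Z : N -> 'rV[R]_n).

(* The tangent space at [p] is represented by 'rV[R]_n: a row vector stands for
   the tangent vector at [p] having these components in the chart [chart_at p].
   [in_chart i p v] gives the components of that vector in the chart [i]. *)
Definition in_chart i p v : 'rV[R]_n :=
  'D_v (chart i \o chart_inv (chart_at p)) (chart (chart_at p) p).

Definition coord_field i (a : 'I_n) : N -> 'rV[R]_n := fun p =>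
  'D_(delta_mx 0 a) (chart (chart_at p) \o chart_inv i) (chart i p).

Definition chart_image i (U : set N) : set 'rV[R]_n :=
  chart i @` (chart_dom i `&` U).

Definition smooth_fun_on (U : set N) (f : N -> R) : Prop :=
  forall i, smooth_on (chart_image i U) (f \o chart_inv i).

(* A vector field [X] assigns to [p] a tangent vector at [p]; its values are
   thus expressed in charts that vary with [p], and smoothness has to be read
   off the components in a fixed chart. *)
Definition field_in_chart i X : 'rV[R]_n -> 'rV[R]_n := fun x =>
  in_chart i (chart_inv i x) (X (chart_inv i x)).

Definition smooth_field_on (U : set N) X : Prop :=
  forall i, smooth_vec_on (chart_image i U) (field_in_chart i X).

Definition smooth_fun_near p (f : N -> R) : Prop :=
  exists U : set N, [/\ open U, U p & smooth_fun_on U f].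

Definition smooth_field_near p X : Prop :=
  exists U : set N, [/\ open U, U p & smooth_field_on U X].

(* the derivative v(f) of a function along a tangent vector *)
Definition deriv_along p v (f : N -> R) : R :=
  'D_v (f \o chart_inv (chart_at p)) (chart (chart_at p) p).

Definition lie_bracket X Y p : 'rV[R]_n :=
  let x := chart (chart_at p) p in
  'D_(X p) (field_in_chart (chart_at p) Y) x -
  'D_(Y p) (field_in_chart (chart_at p) X) x.

Record riemannian_metric := RiemannianMetric {
  metric :> N -> 'rV[R]_n -> 'rV[R]_n -> R;
  metric_linear : forall p a v v' w,
    metric p (a *: v + v') w = a * metric p v w + metric p v' w;
  metric_sym : forall p v w, metric p v w = metric p w v;
  metric_pos : forall p v, v != 0 -> 0 < metric p v v;
  metric_smooth : forall i (a b : 'I_n),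
    smooth_on (chart_image i setT) (fun x =>
      metric (chart_inv i x) (coord_field i a (chart_inv i x))
                             (coord_field i b (chart_inv i x)))
}.

(* [nabla p v Y] is the covariant derivative at [p], in the direction of the
   tangent vector [v], of a vector field [Y] that is smooth near [p].
   Applying the Leibniz rule to the indicator function of a neighbourhood of
   [p] shows that it only depends on the germ of [Y]. *)
Record levi_civita (g : riemannian_metric)
    (nabla : N -> 'rV[R]_n -> (N -> 'rV[R]_n) -> 'rV[R]_n) : Prop :=
  LeviCivita {
  nabla_linear : forall p a v w Y, smooth_field_near p Y ->
    nabla p (a *: v + w) Y = a *: nabla p v Y + nabla p w Y;
  nabla_add : forall p v Y Z,
    smooth_field_near p Y -> smooth_field_near p Z ->
    nabla p v (fun q => Y q + Z q) = nabla p v Y + nabla p v Z;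
  nabla_leibniz : forall p v f Y,
    smooth_fun_near p f -> smooth_field_near p Y ->
    nabla p v (fun q => f q *: Y q) =
      deriv_along p v f *: Y p + f p *: nabla p v Y;
  nabla_smooth : forall (U : set N) X Y, open U ->
    smooth_field_on U X -> smooth_field_on U Y ->
    smooth_field_on U (fun q => nabla q (X q) Y);
  nabla_torsion_free : forall p X Y,
    smooth_field_near p X -> smooth_field_near p Y ->
    nabla p (X p) Y - nabla p (Y p) X = lie_bracket X Y p;
  nabla_metric : forall p v Y Z,
    smooth_field_near p Y -> smooth_field_near p Z ->
    deriv_along p v (fun q => g q (Y q) (Z q)) =
      g p (nabla p v Y) (Z p) + g p (Y p) (nabla p v Z)
}.

Section Geometry.
Variables (g : riemannian_metric)
  (nabla : N -> 'rV[R]_n -> (N -> 'rV[R]_n) -> 'rV[R]_n).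

Definition smooth_curve_on (J : set R) (beta : R -> N) : Prop :=
  forall t, J t -> {for t, continuous beta} /\
    forall i, chart_dom i (beta t) -> forall (a : 'I_n) (k : nat),
      derivable (derive1n k (fun s => chart i (beta s) 0 a)) t 1.

Definition velocity (beta : R -> N) (t : R) : 'rV[R]_n :=
  derive1 (fun s => chart (chart_at (beta t)) (beta s)) t.

(* For Y = sum_a Y^a d_a along beta, this is
   sum_a (Y^a)' d_a + Y^a nabla_{beta'} d_a, computed in the chart
   [chart_at (beta t)]. *)
Definition covariant_deriv_along (beta : R -> N) (Y : R -> 'rV[R]_n) (t : R) :
    'rV[R]_n :=
  let i := chart_at (beta t) in
  derive1 (fun s => in_chart i (beta s) (Y s)) t +
  \sum_(a < n) in_chart i (beta t) (Y t) 0 a *: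
     nabla (beta t) (velocity beta t) (coord_field i a).

Definition geodesic_on (J : set R) (beta : R -> N) : Prop :=
  [/\ is_interval J, open J, smooth_curve_on J beta &
      forall t, J t -> covariant_deriv_along beta (velocity beta) t = 0].

(* When [v] or [w] vanishes, the conventions x / 0 = 0 and acos 0 = pi / 2 make
   the angle pi / 2. *)
Definition angle p v w : R :=
  acos (g p v w / (Num.sqrt (g p v v) * Num.sqrt (g p w w))).

Definition smooth_distribution (D : N -> {vspace 'rV[R]_n}) : Prop :=
  forall p, exists (U : set N) (r : nat) (E : 'I_r -> N -> 'rV[R]_n),
    [/\ open U, U p, forall a, smooth_field_on U (E a) &
        forall q, U q -> basis_of (D q) [seq E a q | a <- enum 'I_r]].

Variable D : N -> {vspace 'rV[R]_n}.

Definition tangential_part q v : 'rV[R]_n :=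
  get [set y | y \in D q /\ forall w, w \in D q -> g q (v - y) w = 0].

Definition normal_part q v : 'rV[R]_n := v - tangential_part q v.

(* the sections of the orthogonal complement of D *)
Definition normal_section (V : N -> 'rV[R]_n) : Prop :=
  smooth_field_on setT V /\ forall q w, w \in D q -> g q (V q) w = 0.

Definition normal_totally_geodesic : Prop :=
  forall U V, normal_section U -> normal_section V ->
    normal_section (fun q => nabla q (U q) V).

(* S_V w = - (component of nabla_w V in D) *)
Definition shape_operator (V : N -> 'rV[R]_n) q w : 'rV[R]_n :=
  - tangential_part q (nabla q w V).

Definition shape_commutator (W V : N -> 'rV[R]_n) q w : 'rV[R]_n :=
  shape_operator W q (shape_operator V q w) -
  shape_operator V q (shape_operator W q w).

End Geometry.
End Manifold.

Section Map.
Variables (R : realType) (m n : nat) (M : manifold R m) (N : manifold R n).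
Variables (gM : riemannian_metric M) (gN : riemannian_metric N) (F : M -> N).

Definition smooth_map : Prop :=
  continuous F /\
  forall i j, smooth_vec_on (chart_image i (F @^-1` chart_dom j))
    (chart j \o F \o chart_inv i).

Definition differential (p : M) (v : 'rV[R]_m) : 'rV[R]_n :=
  'D_v (chart (chart_at (F p)) \o F \o chart_inv (chart_at p))
    (chart (chart_at p) p).

Definition rank_at (p : M) : nat := \rank (lin1_mx (differential p)).

(* the sections of the orthogonal complement of ker F_* *)
Definition horizontal_section (X : M -> 'rV[R]_m) : Prop :=
  smooth_field_on setT X /\
  forall p k, differential p k = 0 -> gM p (X p) k = 0.

Definition riemannian_map : Prop :=
  forall X Y, horizontal_section X -> horizontal_section Y ->
  forall p, gN (F p) (differential p (X p)) (differential p (Y p)) =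
            gM p (X p) (Y p).

(* range F_*, given at the points of F(M), is the restriction of a distribution
   D defined on the whole of N *)
Definition range_distribution (D : N -> {vspace 'rV[R]_n}) : Prop :=
  smooth_distribution D /\
  forall p w, w \in D (F p) <-> exists v, w = differential p v.

Definition clairaut_riemannian_map
    (nabla : N -> 'rV[R]_n -> (N -> 'rV[R]_n) -> 'rV[R]_n)
    (D : N -> {vspace 'rV[R]_n}) (s : N -> R) : Prop :=
  [/\ riemannian_map, forall q, 0 < s q &
   forall (J : set R) (beta : R -> N), geodesic_on nabla J beta ->
   let theta t := angle gN (beta t) (velocity beta t)
                    (normal_part gN D (beta t) (velocity beta t)) in
   forall t1 t2, J t1 -> J t2 ->
     s (beta t1) * sin (theta t1) = s (beta t2) * sin (theta t2)].

End Map.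

(* Main.v *)
(* Write [S_V] for the shape operators and [q = F p].  Clairaut's relation, differentiated along
   the geodesic through [q] with initial velocity [T + V q], where [T] lies in the range, gives
   [df (T + V) |T|^2 = g (nabla_T V, T)], because the total geodesy of the normal distribution
   kills the term [g (nabla_V V, T)].  Adding the same identity for [-T] yields
   [g (nabla_T V, T) = df(V) |T|^2].  The bilinear form [g (nabla_T V, T')] is symmetric on the
   range of [F_*], as the 1-form [g (V, _)] pulls back to zero under [F]; hence, by polarization,
   [S_V T = - df(V) T].  All shape operators are thus scalar at [q], and they commute. *)

Require Import Defs.
From HB Require Import structures.
From mathcomp Require Import all_boot all_order all_algebra.
From mathcomp Require Import all_classical all_reals all_analysis.
From mathcomp Require Import ring lra.
Set Implicit Arguments.
Unset Strict Implicit.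
Unset Printing Implicit Defensive.
Import Order.TTheory GRing.Theory Num.Theory.
Import numFieldNormedType.Exports.
Local Open Scope classical_set_scope.
Local Open Scope ring_scope.

(** * Smooth functions on R^n *)

Section Calculus.
Variable R : realType.

(** Clairaut's relation constrains vectors at [q] only through geodesics, so a geodesic with
    arbitrary initial velocity has to be constructed: Picard iteration in a chart. Since
    [covariant_deriv_along] reads the acceleration at time [t] in [chart_at (beta t)], which may
    change along the curve, the acceleration must also be shown independent of the chart. The angle
    is an [acos] of a quotient of square roots and the projection inside it comes from [get], so
    neither is visibly differentiable in time. The normal part of the velocity is therefore never
    differentiated: it enters through squared lengths only, in a nonnegative function that vanishes
    at time 0. Symmetry of the form is proved by differentiating on [M]. Outside [F(M)] nothing ties
    [D] to [F], so brackets of sections of [D] are not under control, whereas the pulled-back form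
    vanishes on all of [M], and symmetry of second derivatives applies to the components of [F]. *)

Lemma near_eq_differentiable (V W : normedModType R) (f g : V -> W) (x : V) :
  (\near x, f x = g x) -> differentiable f x -> differentiable g x.
Proof.
move=> fg df; have [dc dfE] := (diff_locallyP _ _).1 df.
have gE : g \o shift x = cst (g x) + 'd f x +o_ 0 id.
  apply/eqaddoP => e e0; have /eqaddoP/(_ e e0) := dfE.
  have fg0 : \forall h \near (0 : V), f (h + x) = g (h + x).
    by move: fg; rewrite (near_shift 0 x)/=; apply: filterS => h; rewrite subr0.
  have fgx : f x = g x by exact: nbhs_singleton fg.
  by apply: filterS2 fg0 => h fgh /=; rewrite !fctE/= -fgh -fgx.
by apply/diff_locallyP; rewrite (diff_unique dc gE).
Qed.

Lemma differentiable_rV (V : normedModType R) n (f : V -> 'rV[R]_n) (x : V) :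
  (forall a, differentiable (fun y => f y 0 a) x) -> differentiable f x.
Proof.
move=> df.
have -> : f = \sum_(a < n) (fun y => f y 0 a *: delta_mx 0 a).
  by apply/funext => y; rewrite fct_sumE {1}(row_sum_delta (f y)).
by apply: differentiable_sum => a; exact: differentiableZl.
Qed.

Lemma derive_comp (U V W : normedModType R) (f : U -> V) (g : V -> W) x v :
  differentiable f x -> differentiable g (f x) ->
  'D_v (g \o f) x = 'D_('D_v f x) g (f x).
Proof.
move=> df dg; have dgf := differentiable_comp df dg.
by rewrite (deriveE v dgf) (deriveE v df) (deriveE _ dg) diff_comp.
Qed.

Lemma derive_rV (V : normedModType R) n (f : V -> 'rV[R]_n) (x v : V) a :
  differentiable f x -> ('D_v f x) 0 a = 'D_v (fun y => f y 0 a) x.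
Proof. by move=> df; rewrite derive_mx ?mxE//; exact: diff_derivable. Qed.

Lemma derive_linear (V W : normedModType R) (f : V -> W) x (k : R) u v :
  differentiable f x -> 'D_(k *: u + v) f x = k *: 'D_u f x + 'D_v f x.
Proof. by move=> df; rewrite !(deriveE _ df) linearP. Qed.

Lemma derive_sum_delta (W : normedModType R) n (f : 'rV[R]_n -> W) x v :
  differentiable f x ->
  'D_v f x = \sum_(a < n) v 0 a *: 'D_(delta_mx 0 a) f x.
Proof.
move=> df; rewrite deriveE// {1}(row_sum_delta v) linear_sum.
by apply: eq_bigr => a _; rewrite linearZ deriveE.
Qed.

Implicit Types (n : nat).

(** Chart expressions are total functions with irrelevant values off an open set, so regularity is
    proved for a convenient formula and transported by this lemma. Openness turns equality on [U]
    into equality near each of its points, which derivatives require. *)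
Lemma eq_Ck_on n k (U : set 'rV[R]_n) f g : open U ->
  (forall x, U x -> f x = g x) -> Ck_on k U f -> Ck_on k U g.
Proof.
move=> oU; elim: k f g => [|k IH] f g fg /=.
  move=> cf x Ux; have fgx : \near x, f x = g x.
    by have := open_nbhs_nbhs (conj oU Ux); apply: filterS.
  have := cf x Ux; rewrite /prop_for /continuous_at -(fg _ Ux).
  move=> cfx; apply: cvg_trans cfx; apply: (near_eq_cvg fgx).
have fgx x : U x -> \near x, f x = g x.
  by move=> Ux; have := open_nbhs_nbhs (conj oU Ux); apply: filterS.
move=> [df Df]; split=> [x Ux|i].
  exact: near_eq_differentiable (fgx x Ux) (df x Ux).
by apply: IH (Df i) => x Ux; exact: near_eq_derive (fgx x Ux).
Qed.

Lemma eq_smooth_on n (U : set 'rV[R]_n) f g : open U ->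
  (forall x, U x -> f x = g x) -> smooth_on U f -> smooth_on U g.
Proof. by move=> oU fg sf k; exact: eq_Ck_on (sf k). Qed.

Lemma smooth_on_subset n (U U' : set 'rV[R]_n) f :
  U' `<=` U -> smooth_on U f -> smooth_on U' f.
Proof.
move=> U'U sf k; move: (sf k); elim: k {sf} f => [|k IH] f /=.
  by move=> cf x /U'U; exact: cf.
by move=> [df Df]; split=> [x /U'U|i]; [exact: df|exact: IH].
Qed.

Lemma smooth_on_differentiable n (U : set 'rV[R]_n) f x :
  smooth_on U f -> U x -> differentiable f x.
Proof. by move=> /(_ 1%N)[df _]; exact: df. Qed.

Lemma smooth_on_continuous n (U : set 'rV[R]_n) f x :
  smooth_on U f -> U x -> {for x, continuous f}.
Proof. by move=> sf Ux; exact: differentiable_continuous (smooth_on_differentiable sf Ux). Qed.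

Lemma smooth_on_derive_delta n (U : set 'rV[R]_n) f i :
  smooth_on U f -> smooth_on U (fun x => 'D_(delta_mx 0 i) f x).
Proof. by move=> sf k; have [_ /(_ i)] := sf k.+1. Qed.

Lemma Ck_on_weaken n k (U : set 'rV[R]_n) f : Ck_on k.+1 U f -> Ck_on k U f.
Proof.
elim: k f => [|k IH] f.
  by move=> /= [df _] x Ux; exact: differentiable_continuous (df x Ux).
by move=> [df Df]; split=> // i; exact/IH/Df.
Qed.

Lemma Ck_onD n k (U : set 'rV[R]_n) f g : open U ->
  Ck_on k U f -> Ck_on k U g -> Ck_on k U (fun x => f x + g x).
Proof.
move=> oU; elim: k f g => [|k IH] f g /=.
  by move=> cf cg x Ux; apply: continuousD; [exact: cf|exact: cg].
move=> [df Df] [dg Dg]; split=> [x Ux|i].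
  by apply: differentiableD; [exact: df|exact: dg].
apply: (eq_Ck_on oU _ (IH _ _ (Df i) (Dg i))) => x Ux.
by rewrite deriveD//; apply: diff_derivable; [exact: df|exact: dg].
Qed.

Lemma Ck_onM n k (U : set 'rV[R]_n) f g : open U ->
  Ck_on k U f -> Ck_on k U g -> Ck_on k U (fun x => f x * g x).
Proof.
move=> oU; elim: k f g => [|k IH] f g.
  by move=> cf cg x Ux; apply: continuousM; [exact: cf|exact: cg].
move=> Cf Cg; have [df Df] := Cf; have [dg Dg] := Cg; split=> [x Ux|i].
  by apply: differentiableM; [exact: df|exact: dg].
(* The Leibniz formula pairs each undifferentiated factor with a derivative of the other, so the
   former is weakened by one order. *)
have Cfg := Ck_onD oU (IH _ _ (Ck_on_weaken Cf) (Dg i)) (IH _ _ (Ck_on_weaken Cg) (Df i)).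
apply: (eq_Ck_on oU _ Cfg) => x Ux.
have [fv gv] : derivable f x (delta_mx 0 i) /\ derivable g x (delta_mx 0 i).
  by split; apply: diff_derivable; [exact: df|exact: dg].
by rewrite (deriveM fv gv).
Qed.

Lemma smooth_onD n (U : set 'rV[R]_n) f g : open U ->
  smooth_on U f -> smooth_on U g -> smooth_on U (fun x => f x + g x).
Proof. by move=> oU sf sg k; exact: Ck_onD. Qed.

Lemma smooth_onM n (U : set 'rV[R]_n) f g : open U ->
  smooth_on U f -> smooth_on U g -> smooth_on U (fun x => f x * g x).
Proof. by move=> oU sf sg k; exact: Ck_onM. Qed.

Lemma smooth_on_cst n (U : set 'rV[R]_n) (c : R) : smooth_on U (fun=> c).
Proof.
move=> k; elim: k c => [|k IH] c /=; first by move=> x _; exact: cst_continuous.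
split=> [x Ux|i]; first exact: differentiable_cst.
have -> : (fun x => 'D_(delta_mx 0 i) (fun=> c) x) = (fun=> 0) :> ('rV[R]_n -> R).
  by apply/funext => x; exact: derive_cst.
exact: IH.
Qed.

Lemma smooth_onZ n (U : set 'rV[R]_n) (c : R) f : open U ->
  smooth_on U f -> smooth_on U (fun x => c * f x).
Proof. by move=> oU; apply: smooth_onM => //; exact: smooth_on_cst. Qed.

Lemma Ck_on_sum n k (U : set 'rV[R]_n) m (f : 'I_m -> 'rV[R]_n -> R) : open U ->
  (forall i, Ck_on k U (f i)) -> Ck_on k U (fun x => \sum_i f i x).
Proof.
move=> oU sf.
rewrite (_ : (fun x => _) = \sum_i f i); last first.
  by apply/funext => x; rewrite fct_sumE.
elim/big_ind : _ => //; first exact: smooth_on_cst.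
by move=> g h sg sh; exact: Ck_onD.
Qed.

Lemma smooth_on_sum n (U : set 'rV[R]_n) m (f : 'I_m -> 'rV[R]_n -> R) : open U ->
  (forall i, smooth_on U (f i)) -> smooth_on U (fun x => \sum_i f i x).
Proof.
by move=> oU sf k; apply: Ck_on_sum => // i; exact: sf.
Qed.

Lemma smooth_on_derive n (U : set 'rV[R]_n) f v : open U ->
  smooth_on U f -> smooth_on U (fun x => 'D_v f x).
Proof.
move=> oU sf.
have : smooth_on U (fun x => \sum_(a < n) v 0 a * 'D_(delta_mx 0 a) f x).
  by apply: smooth_on_sum => // a; apply: smooth_onZ => //; exact: smooth_on_derive_delta.
apply: eq_smooth_on => // x Ux; rewrite [RHS]derive_sum_delta//.
exact: smooth_on_differentiable Ux.
Qed.

Lemma smooth_vec_on_differentiable n n' (U : set 'rV[R]_n) (f : 'rV[R]_n -> 'rV[R]_n') x :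
  smooth_vec_on U f -> U x -> differentiable f x.
Proof. by move=> sf Ux; apply: differentiable_rV => a; exact: smooth_on_differentiable Ux. Qed.

Lemma smooth_vec_on_subset n n' (U U' : set 'rV[R]_n) (f : 'rV[R]_n -> 'rV[R]_n') :
  U' `<=` U -> smooth_vec_on U f -> smooth_vec_on U' f.
Proof. by move=> U'U sf a; exact: smooth_on_subset (sf a). Qed.

Lemma smooth_on_comp n n' (U : set 'rV[R]_n) (W : set 'rV[R]_n')
    (phi : 'rV[R]_n -> 'rV[R]_n') h : open U -> (forall x, U x -> W (phi x)) ->
  smooth_vec_on U phi -> smooth_on W h -> smooth_on U (h \o phi).
Proof.
move=> oU UW sphi.
(* The induction on [k] must range over all smooth [g]: the chain rule produces compositions of
   [phi] with the partial derivatives of [g]. *)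
suff H k g : smooth_on W g -> Ck_on k U (g \o phi).
  by move=> sh k; exact: H.
elim: k g => [|k IH] g sg /=.
  move=> x Ux; apply: continuous_comp; last exact: smooth_on_continuous (UW _ Ux).
  exact: differentiable_continuous (smooth_vec_on_differentiable sphi Ux).
have dphi x : U x -> differentiable phi x by exact: smooth_vec_on_differentiable.
have dg x : U x -> differentiable g (phi x).
  by move=> Ux; exact: smooth_on_differentiable (UW _ Ux).
split=> [x Ux|i]; first exact: differentiable_comp (dphi x Ux) (dg x Ux).
have Csum : Ck_on k U (fun x =>
    \sum_(a < n') 'D_(delta_mx 0 i) (fun y => phi y 0 a) x * 'D_(delta_mx 0 a) g (phi x)).
  apply: Ck_on_sum => // a; apply: Ck_onM => //; first exact: smooth_on_derive_delta.
  exact: (IH _ (smooth_on_derive_delta a sg)).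
apply: (eq_Ck_on oU _ Csum) => x Ux.
rewrite (derive_comp _ (dphi x Ux) (dg x Ux)) [RHS](derive_sum_delta _ (dg x Ux)).
by apply: eq_bigr => a _; rewrite derive_rV//; exact: dphi.
Qed.

End Calculus.

(** * Symmetry of second derivatives *)

Section Schwarz.
Variable R : realType.
Implicit Types (n : nat).

Lemma is_derive_line n (f : 'rV[R]_n -> R) (y u : 'rV[R]_n) (s : R) :
  differentiable f (y + s *: u) ->
  is_derive s 1 (fun s => f (y + s *: u)) ('D_u f (y + s *: u)).
Proof.
move=> df.
have dl : differentiable (fun s : R => y + s *: u) s.
  exact: differentiableD.
apply: DeriveDef.
  exact/derivable1_diffP/(differentiable_comp dl df).
rewrite (derive_comp _ dl df); congr ('D__ f _).
by rewrite deriveE// diff_val /= add0r scale1r.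
Qed.

Lemma mean_value_line n (f : 'rV[R]_n -> R) (y u : 'rV[R]_n) (h : R) : 0 < h ->
  (forall s, 0 <= s <= h -> differentiable f (y + s *: u)) ->
  exists2 s, 0 <= s <= h & f (y + h *: u) - f y = h * 'D_u f (y + s *: u).
Proof.
move=> h0 df; have := @MVT _ (fun s => f (y + s *: u)) (fun s => 'D_u f (y + s *: u)) 0 h h0.
case.
- move=> s; rewrite in_itv/= => /andP[s0 sh]; apply: is_derive_line; apply: df.
  by rewrite !ltW.
- apply: derivable_within_continuous => s; rewrite in_itv/= => s0h.
  by have [] := is_derive_line (df _ s0h).
- move=> s; rewrite in_itv/= => /andP[s0 sh]; rewrite scale0r addr0 subr0 => E.
  by exists s; rewrite ?ltW// mulrC.
Qed.

(** The mean value theorem is applied twice: along [u] to the increment [f (y + h *: v) - f y], then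
    along [v] to ['D_u f]. The left-hand side is symmetric in [u] and [v], the right-hand side is
    not visibly so. *)
Lemma second_difference n (U : set 'rV[R]_n) (f : 'rV[R]_n -> R) x u v h :
  open U -> smooth_on U f -> 0 < h ->
  (forall s t, 0 <= s <= h -> 0 <= t <= h -> U (x + s *: u + t *: v)) ->
  exists s t, [/\ 0 <= s <= h, 0 <= t <= h &
    f (x + h *: u + h *: v) - f (x + h *: u) - f (x + h *: v) + f x =
    h ^+ 2 * 'D_v (fun y => 'D_u f y) (x + s *: u + t *: v)].
Proof.
move=> oU sf h0 Ust.
have h00 : 0 <= (0 : R) <= h by rewrite lexx ltW.
have hh : 0 <= h <= h by rewrite lexx ltW.
pose g y := f (y + h *: v) - f y.
have dshift (y w : 'rV[R]_n) : differentiable (fun z => z + w) y by exact: differentiableD.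
have df y : U y -> differentiable f y by exact: smooth_on_differentiable sf.
have dfh y : U (y + h *: v) -> differentiable (fun z => f (z + h *: v)) y.
  move=> Uy.
  exact: (@differentiable_comp _ _ _ _ (fun z => z + h *: v) f _ (dshift _ _) (df _ Uy)).
have dg s : 0 <= s <= h -> differentiable g (x + s *: u).
  move=> s0h; apply: differentiableB; first by apply: dfh; exact: Ust.
  by apply: df; have := Ust s 0 s0h h00; rewrite scale0r addr0.
have [s s0h gE] := mean_value_line h0 dg.
have Us := Ust s 0 s0h h00; rewrite scale0r addr0 in Us.
have sDf := smooth_on_derive u oU sf.
have [t t0h DE] := @mean_value_line _ (fun y => 'D_u f y) (x + s *: u) v h h0
   (fun t t0h => smooth_on_differentiable sDf (Ust s t s0h t0h)).
exists s, t; split=> //.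
rewrite expr2 -mulrA -DE.
have -> : 'D_u f (x + s *: u + h *: v) - 'D_u f (x + s *: u) = 'D_u g (x + s *: u).
  have d1 := dfh _ (Ust s h s0h hh).
  rewrite /g (deriveB (f := fun z => f (z + h *: v)) (g := f)); last 2 first.
  - exact: diff_derivable.
  - by apply: diff_derivable; exact: df.
  congr (_ - _); rewrite (@derive_comp _ _ _ _ (fun z => z + h *: v) f)//; last exact/df/Ust.
  congr ('D__ f _).
  by rewrite deriveD// derive_cst addr0 derive_id.
by rewrite -gE /g; ring.
Qed.

(** Each iterated derivative, at some point close to [x], equals the same second difference divided
    by [h ^+ 2]; continuity of both at [x] then forces equality. *)
Lemma derive_swap n (U : set 'rV[R]_n) (f : 'rV[R]_n -> R) x u v :
  open U -> smooth_on U f -> U x ->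
  'D_v (fun y => 'D_u f y) x = 'D_u (fun y => 'D_v f y) x.
Proof.
move=> oU sf Ux.
set A := fun y => 'D_v (fun y => 'D_u f y) y.
set B := fun y => 'D_u (fun y => 'D_v f y) y.
change (A x = B x).
have cA : {for x, continuous A}.
  by apply: smooth_on_continuous Ux; do 2 apply: smooth_on_derive => //.
have cB : {for x, continuous B}.
  by apply: smooth_on_continuous Ux; do 2 apply: smooth_on_derive => //.
apply/eqP; rewrite -subr_eq0 -normr_eq0; apply/eqP/le_anti; rewrite normr_ge0 andbT.
apply/ler_addgt0Pr => e e0; rewrite add0r.
have e20 : 0 < e / 2 by rewrite divr_gt0.
move/cvgrPdist_lt : cA => /(_ _ e20) nA.
move/cvgrPdist_lt : cB => /(_ _ e20) nB.
have nU := open_nbhs_nbhs (conj oU Ux).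
have [r /= r0 rP] := (nbhs_ballP _ _).1 (filterI nU (filterI nA nB)).
(* This makes the parallelogram with sides [h *: u] and [h *: v] fit into the ball of radius [r], on
   which both derivatives vary by less than [e / 2]. The added 1 covers [u = v = 0]. *)
pose h := r / (2 * (`|u| + `|v| + 1)).
have D0 : 0 < 2 * (`|u| + `|v| + 1) by rewrite mulr_gt0// ltr_wpDl// addr_ge0.
have h0 : 0 < h by rewrite divr_gt0.
have hr s t : 0 <= s <= h -> 0 <= t <= h -> ball x r (x + s *: u + t *: v).
  move=> /andP[s0 sh] /andP[t0 th].
  rewrite -ball_normE/= -addrA opprD addrA subrr add0r normrN.
  apply: le_lt_trans (ler_normD _ _) _; rewrite !normrZ !ger0_norm//.
  apply: (@le_lt_trans _ _ (h * (`|u| + `|v| + 1))).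
    by rewrite !mulrDr mulr1 -addrA lerD// ?ler_wpM2r// -[leLHS]addr0 lerD ?ler_wpM2r// ltW.
  rewrite /h invfM mulrA mulfVK ?lt0r_neq0 ?ltr_wpDl// ?addr_ge0//.
  by rewrite ltr_pdivrMr// ltr_pMr// ltr1n.
have rU s t : 0 <= s <= h -> 0 <= t <= h -> U (x + s *: u + t *: v).
  by move=> sh th; have [] := rP _ (hr _ _ sh th).
have rU' s t : 0 <= s <= h -> 0 <= t <= h -> U (x + s *: v + t *: u).
  by move=> sh th; rewrite addrAC; exact: rU.
have [s [t [sh th E1]]] := second_difference oU sf h0 rU.
have [s' [t' [sh' th' E2]]] := second_difference oU sf h0 rU'.
have [_ [A1 _]] := rP _ (hr _ _ sh th).
have [_ [_ B1]] := rP _ (hr _ _ th' sh').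
(* The two second differences agree up to the order of the terms, and [h ^+ 2] cancels. *)
have AB : A (x + s *: u + t *: v) = B (x + t' *: u + s' *: v).
  apply: (mulfI (lt0r_neq0 (exprn_gt0 2 h0))).
  apply: (etrans (esym E1)); rewrite (addrAC x (t' *: u)); apply: (etrans _ E2).
  by rewrite (addrAC x (h *: v)); congr (_ + _); exact: addrAC.
clearbody A B; rewrite /= ?AB in A1 B1.
rewrite -(subrKA (B (x + t' *: u + s' *: v))) (splitr e).
apply: le_trans (ler_normD _ _) _; apply: lerD; first exact: ltW.
by rewrite distrC ltW.
Qed.

End Schwarz.

(** * Ordinary differential equations *)

Section Picard.
Variable R : realType.
Implicit Types (n : nat).

Definition clamp (a b x : R) : R := Num.max a (Num.min b x).

Lemma clamp_itv a b x : a <= b -> a <= clamp a b x <= b.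
Proof.
move=> ab; rewrite /clamp.
by case: (leP b x) => ?; case: (leP a b) => ?; case: (leP a x) => ?; lra.
Qed.

Lemma clamp_id a b x : a <= x <= b -> clamp a b x = x.
Proof.
move=> /andP[ax xb]; rewrite /clamp.
by case: (leP b x) => ?; case: (leP a b) => ?; case: (leP a x) => ?; lra.
Qed.

Lemma clamp_lipschitz a b x y : `|clamp a b x - clamp a b y| <= `|x - y|.
Proof.
wlog xy : x y / x <= y.
  move=> H; have [|/ltW yx] := leP x y; first exact: H.
  by rewrite distrC (distrC x); exact: H.
rewrite distrC (distrC x) (ger0_norm (_ : 0 <= y - x)) ?subr_ge0//.
have mxy : Num.min b x <= Num.min b y <= Num.min b x + (y - x).
  by case: (leP b x) => ?; case: (leP b y) => ?; lra.
rewrite /clamp; move: (Num.min b x) (Num.min b y) mxy => u w uw.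
rewrite ger0_norm; by case: (leP a u) => ?; case: (leP a w) => ?; lra.
Qed.

Lemma lipschitz_continuous (V W : normedModType R) (K : R) (f : V -> W) :
  (forall x y, `|f x - f y| <= K * `|x - y|) -> continuous f.
Proof.
move=> fK x; apply/cvgrPdist_lt => e e0.
have K0 : 0 < `|K| + 1 by rewrite ltr_wpDl.
near=> y; apply: le_lt_trans (fK _ _) _.
apply: (@le_lt_trans _ _ ((`|K| + 1) * `|x - y|)).
  by rewrite ler_wpM2r// (le_trans (ler_norm _))// lerDl.
rewrite mulrC -ltr_pdivlMr//.
near: y; apply: cvgr_dist_lt; last exact: divr_gt0.
exact: cvg_id.
Unshelve. all: by end_near. Qed.

Lemma mx_norm_le n (v : 'rV[R]_n) (C : R) : 0 <= C ->
  (forall a, `|v 0 a| <= C) -> `|v| <= C.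
Proof.
move=> C0 vC; rewrite [leLHS]/Num.Def.normr/= mx_normrE bigmax_le// => -[i j] _ /=.
by rewrite ord1.
Qed.

Lemma mx_norm_ge n (v : 'rV[R]_n) a : `|v 0 a| <= `|v|.
Proof. by rewrite [leRHS]/Num.Def.normr/= mx_normrE; exact: (le_bigmax _ _ (0, a)). Qed.

Lemma is_derive_rV n (y : R -> 'rV[R]_n) (d : 'rV[R]_n) (t : R) :
  (forall a, is_derive t 1 (fun s => y s 0 a) (d 0 a)) -> is_derive t 1 y d.
Proof.
move=> yd; have dy : derivable y t 1.
  by apply/derivable_mxP => i a; rewrite ord1; have [] := yd a.
apply: DeriveDef => //; rewrite derive_mx//; apply/rowP => a.
by rewrite mxE; have [_ ->] := yd a.
Qed.

Lemma is_derive_rVE n (y : R -> 'rV[R]_n) (d : 'rV[R]_n) (t : R) a :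
  is_derive t 1 y d -> is_derive t 1 (fun s => y s 0 a) (d 0 a).
Proof.
move=> [dy <-]; apply: DeriveDef; first exact: (derivable_mxP y t 1).1.
by rewrite derive_mx// mxE.
Qed.

(** Integrating from [-1] rather than from [0] makes [0] an interior point, so that the derivative
    there is two-sided; subtracting [I 0] restores the normalization. *)
Lemma primitive_exists (h : R -> R) : continuous h ->
  exists P, P 0 = 0 /\ forall t : R, -1 < t < 1 -> is_derive t 1 P (h t).
Proof.
move=> ch.
pose I x := (\int[lebesgue_measure]_(t in `[-1, x]) h t)%R.
exists (fun x => I x - I 0); split; first by rewrite subrr.
move=> t /andP[t1 t2].
have hi : (@lebesgue_measure R).-integrable `[-1, 1] (EFin \o h).
  apply: continuous_compact_integrable; first exact: segment_compact.
  exact: continuous_subspaceT.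
have [dI I'] := continuous_FTC1_closed t2 hi t1 (ch t).
have isI : is_derive t 1 I (h t).
  by split; [exact: dI|rewrite -derive1E; exact: I'].
by rewrite -[h t]subr0; exact: is_deriveB.
Qed.

Lemma mean_value_bound (D d : R -> R) (C r : R) : D 0 = 0 ->
  (forall t : R, -r < t < r -> is_derive t 1 D (d t)) ->
  (forall t, -r < t < r -> `|d t| <= C) ->
  forall t, -r < t < r -> `|D t| <= C * `|t|.
Proof.
move=> D0 Dd dC t tr.
have [t0|t0|->] := ltgtP t 0; last by rewrite D0 !normr0 mulr0.
- have [||c] := @MVT _ D d t 0 t0.
  + by move=> x; rewrite in_itv/= => xt; apply: Dd; lra.
  + apply: derivable_within_continuous => x; rewrite in_itv/= => xt.
    by have [] := Dd x; [lra|].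
  rewrite in_itv/= D0 !sub0r => ct E; rewrite -[D t]opprK E !normrN mulrN normrN normrM.
  by rewrite ler_wpM2r//; apply: dC; lra.
- have [||c] := @MVT _ D d 0 t t0.
  + by move=> x; rewrite in_itv/= => xt; apply: Dd; lra.
  + apply: derivable_within_continuous => x; rewrite in_itv/= => xt.
    by have [] := Dd x; [lra|].
  rewrite in_itv/= D0 !subr0 => ct ->; rewrite normrM.
  by rewrite ler_wpM2r//; apply: dC; lra.
Qed.

Lemma le0_geometric (C x : R) : (forall k, x <= C / 2 ^+ k) -> x <= 0.
Proof.
move=> xC; rewrite leNgt; apply/negP => x0.
have := xC (Num.bound (C / x)); apply/negP; rewrite -ltNge.
by rewrite ltr_pdivrMr ?exprn_gt0// mulrC -ltr_pdivrMr//; exact: upper_nthrootP.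
Qed.

Lemma geometric_limit n (u : nat -> 'rV[R]_n) (C : R) :
  (forall k, `|u k.+1 - u k| <= C / 2 ^+ k) ->
  exists l, forall k, `|l - u k| <= 2 * C / 2 ^+ k.
Proof.
move=> uC.
have C0 : 0 <= C by have := le_trans (normr_ge0 _) (uC 0%N); rewrite expr0 divr1.
(* The subtracted tail is what lets the induction on [m] close. *)
have uD k m : `|u (k + m)%N - u k| <= 2 * C / 2 ^+ k - 2 * C / 2 ^+ (k + m).
  elim: m => [|m IH]; first by rewrite addn0 !subrr normr0.
  rewrite addnS -(subrKA (u (k + m)%N)); apply: le_trans (ler_normD _ _) _.
  apply: le_trans (lerD (uC _) IH) _; rewrite exprS invfM.
  by set z := (2 ^+ (k + m))^-1; set w := _^-1; lra.
have uD' k m : (k <= m)%N -> `|u m - u k| <= 2 * C / 2 ^+ k.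
  move=> km; rewrite -(subnKC km); apply: le_trans (uD _ _) _.
  by rewrite gerBl mulr_ge0// ?mulr_ge0// invr_ge0 exprn_ge0.
have cu : cvg (u @ \oo).
  apply/cauchy_cvgP/cauchy_exP => e e0.
  have [k kC] : exists k, 2 * C / 2 ^+ k < e.
    apply: contrapT => /forallNP H.
    have : e <= 0 by apply: (@le0_geometric (2 * C)) => k; rewrite leNgt; exact/negP.
    by rewrite leNgt e0.
  exists (u k); exists k => // m /= km.
  by rewrite -ball_normE /= distrC; apply: le_lt_trans kC; exact: uD'.
exists (limn u) => k; apply/ler_addgt0Pl => e e0.
have [m _ um] := cvgr_dist_le _ _ cu _ e0.
rewrite -(subrKA (u (maxn m k))); apply: le_trans (ler_normD _ _) _.
by apply: lerD; [apply: um; exact: leq_maxl | apply: uD'; exact: leq_maxr].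
Qed.

(* Picard iteration; time is clamped so that the iterates are defined and continuous on all of
   [R], and contract by 1/2 in the uniform norm. *)
Lemma picard_lipschitz n (G : 'rV[R]_n -> 'rV[R]_n) (L : R) y0 : 0 <= L ->
  (forall y z, `|G y - G z| <= L * `|y - z|) ->
  exists2 delta, 0 < delta & exists y : R -> 'rV[R]_n,
    y 0 = y0 /\ forall t : R, -delta < t < delta -> is_derive t 1 y (G (y t)).
Proof.
move=> L0 GL.
have [prim primP] : exists prim : (R -> R) -> R -> R, forall h, continuous h ->
    prim h 0 = 0 /\ forall t : R, -1 < t < 1 -> is_derive t 1 (prim h) (h t).
  (* Choice needs a witness for every [h]; a discontinuous one receives [h] itself as an arbitrary
     value. *)
  have /choice[prim primP] : forall h : R -> R, exists P : R -> R, continuous h ->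
      P 0 = 0 /\ forall t : R, -1 < t < 1 -> is_derive t 1 P (h t).
    move=> h; have [ch|nch] := pselect (continuous h); last by exists h => /nch.
    by have [P PP] := primitive_exists ch; exists P.
  by exists prim.
(* Two requirements: [delta * L] at most 1/2, for the contraction, and [delta] below 1, to stay
   where the primitives are differentiable. *)
pose delta := (2 * (L + 1))^-1.
have dL : delta * L <= 2^-1.
  by rewrite /delta invfM -mulrA ler_piMr// mulrC ler_pdivrMr ?mul1r ?lerDl// ltr_wpDl.
have d0 : 0 < delta by rewrite invr_gt0 mulr_gt0// ltr_wpDl.
have d1 : delta <= 2^-1 by rewrite lef_pV2 ?posrE ?mulr_gt0// ?ltr_wpDl// ler_peMr// lerDr.
pose kappa := clamp (- delta) delta.
have kd t : - delta <= kappa t <= delta by apply: clamp_itv; lra.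
have k1 t : -1 < kappa t < 1 by have := kd t; lra.
have kc : continuous kappa.
  by apply: (@lipschitz_continuous _ _ 1) => x y; rewrite mul1r; exact: clamp_lipschitz.
have Gc : continuous G by exact: lipschitz_continuous GL.
pose comp_G (y : R -> 'rV[R]_n) (a : 'I_n) (s : R) := G (y s) 0 a.
have cG y a : continuous y -> continuous (comp_G y a).
  move=> cy s; apply: (@continuous_comp _ _ _ (fun s => G (y s)) (fun v => v 0 a)).
    exact: continuous_comp (cy s) (Gc _).
  exact: coord_continuous.
pose Phi (y : R -> 'rV[R]_n) t := y0 + \row_a prim (comp_G y a) (kappa t).
have PhiE y t a : (Phi y t) 0 a = y0 0 a + prim (comp_G y a) (kappa t) by rewrite !mxE.
have Phi_cont y : continuous y -> continuous (Phi y).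
  move=> cy t; apply: continuousD; first exact: cst_continuous.
  rewrite /continuous_at; apply/cvgrPdist_le => e e0.
  have H a : \forall s \near t,
      `|prim (comp_G y a) (kappa t) - prim (comp_G y a) (kappa s)| <= e.
    have [_ /(_ _ (k1 t)) [dp _]] := primP _ (cG y a cy).
    have cp : {for kappa t, continuous (prim (comp_G y a))}.
      exact/differentiable_continuous/derivable1_diffP.
    have cpk : {for t, continuous (prim (comp_G y a) \o kappa)}.
      exact: continuous_comp (kc t) cp.
    exact: (cvgrPdist_le _ _).1 cpk e e0.
  have : \forall s \near t, forall a,
      `|prim (comp_G y a) (kappa t) - prim (comp_G y a) (kappa s)| <= e.
    pose f a : set R := fun s =>
      `|prim (comp_G y a) (kappa t) - prim (comp_G y a) (kappa s)| <= e.
    exact: (@filter_forall R _ f (nbhs t) _ H).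
  apply: filterS => s Hs; apply: mx_norm_le; first exact: ltW.
  by move=> a; rewrite !mxE.
(* The integrands differ by at most [L * B] and the clamped time is at most [delta] in absolute
   value, whence the factor [delta * L]. *)
have Phi_diff y z B : continuous y -> continuous z ->
    (forall t, `|y t - z t| <= B) -> forall t, `|Phi y t - Phi z t| <= B / 2.
  move=> cy cz yzB t.
  have B0 : 0 <= B by exact: le_trans (yzB 0).
  apply: mx_norm_le; first by rewrite divr_ge0.
  move=> a; rewrite !mxE opprD addrACA subrr add0r.
  have [py0 pyd] := primP _ (cG y a cy); have [pz0 pzd] := primP _ (cG z a cz).
  have := @mean_value_bound (fun s => prim (comp_G y a) s - prim (comp_G z a) s)
    (fun s => comp_G y a s - comp_G z a s) (L * B) 1.
  rewrite py0 pz0 subrr => /(_ erefl) H.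
  apply: (le_trans (H _ _ _ (k1 t))).
  - by move=> s s1; apply: is_deriveB; [exact: pyd|exact: pzd].
  - move=> s _; rewrite /comp_G.
    have -> : G (y s) 0 a - G (z s) 0 a = (G (y s) - G (z s)) 0 a by rewrite !mxE.
    apply: le_trans (mx_norm_ge _ _) _; apply: le_trans (GL _ _) _.
    by rewrite ler_wpM2l.
  - apply: (@le_trans _ _ (L * B * delta)).
      by rewrite ler_wpM2l ?mulr_ge0// ler_norml; exact: kd.
    by rewrite mulrC mulrA mulrC ler_wpM2l.
pose u k := iter k Phi (cst y0).
have uc k : continuous (u k).
  by elim: k => [|k IH]; [exact: cst_continuous | exact: Phi_cont].
pose C := `|G y0|.
have C0 : 0 <= C by exact: normr_ge0.
have uC k t : `|u k.+1 t - u k t| <= C / 2 ^+ k.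
  elim: k t => [|k IH] t.
    rewrite expr0 divr1 /u /= addrAC subrr add0r; apply: mx_norm_le => // a.
    rewrite !mxE.
    have [p0 pd] := primP _ (cG (cst y0) a (@cst_continuous _ _ _)).
    have H := mean_value_bound p0 pd (C := C).
    apply: (le_trans (H _ _ (k1 t))).
      by move=> s _; exact: mx_norm_ge.
    by rewrite ler_piMr// ltW// ltr_norml; exact: k1.
  rewrite exprS invfM mulrCA mulrC.
  exact: (Phi_diff (u k.+1) (u k)).
have /choice[y yP] : forall t, exists l, forall k, `|l - u k t| <= 2 * C / 2 ^+ k.
  by move=> t; apply: geometric_limit => k; exact: uC.
have cy : continuous y.
  move=> t; apply/cvgrPdist_le => e e0.
  have [k kC] : exists k, 2 * C / 2 ^+ k < e / 3.
    apply: contrapT => /forallNP H.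
    have : e / 3 <= 0 by apply: (@le0_geometric (2 * C)) => k; rewrite leNgt; exact/negP.
    by rewrite leNgt divr_gt0.
  have e30 : 0 < e / 3 by rewrite divr_gt0.
  have nu : \forall s \near t, `|u k t - u k s| <= e / 3.
    by exact: (cvgrPdist_le _ _).1 (uc k t) _ e30.
  apply: filterS nu => s us.
  have y1 := le_trans (yP t k) (ltW kC).
  have y2 := le_trans (yP s k) (ltW kC).
  rewrite -(subrKA (u k t)) -(subrKA (u k s) (u k t)).
  apply: le_trans (ler_normD _ _) _; apply: le_trans (lerD (lexx _) (ler_normD _ _)) _.
  rewrite (distrC (u k s) (y s)); move: y1 y2 us.
  by set n1 := `|_|; set n2 := `|_|; set n3 := `|_|; lra.
(* Both sides are within [C / 2 ^+ k] of [u k.+1 t]: the left one by contraction, the right one by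
   the choice of [y]. *)
have Phiy t : Phi y t = y t.
  apply/eqP; rewrite -subr_eq0 -normr_le0.
  apply: (@le0_geometric (2 * C)) => k.
  have H1 : `|Phi y t - u k.+1 t| <= 2 * C / 2 ^+ k / 2.
    by apply: (Phi_diff y (u k)) => // s; exact: yP.
  have H2 := yP t k.+1.
  rewrite -(subrKA (u k.+1 t)); apply: le_trans (ler_normD _ _) _.
  rewrite (distrC (u k.+1 t)); apply: le_trans (lerD H1 H2) _.
  by rewrite exprS invfM; set z := (2 ^+ k)^-1; lra.
exists delta => //; exists y; split.
  rewrite -Phiy; apply/rowP => a; rewrite PhiE /kappa clamp_id; last by lra.
  by have [-> _] := primP _ (cG y a cy); rewrite addr0.
move=> t td; apply: is_derive_rV => a.
have [_ pd] := primP _ (cG y a cy).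
have t1 : -1 < t < 1 by lra.
have pdt : is_derive t 1 (fun s => y0 0 a + prim (comp_G y a) s) (comp_G y a t).
  by rewrite -[comp_G y a t]add0r; apply: is_deriveD; exact: pd.
apply: near_eq_is_derive pdt.
(* Near [t] the clamp is the identity, so the fixed point equation presents each component of [y] as
   a constant plus a primitive. *)
have : \forall s \near t, s \in `]-delta, delta[ by apply: near_in_itvoo; rewrite in_itv.
apply: filterS => s; rewrite in_itv/= => sd.
by rewrite -Phiy PhiE /kappa clamp_id//; lra.
Qed.

(** Clamping each coordinate retracts the space onto the ball of radius [r], which is a cube for
    this norm, without increasing distances; [G \o c] is thus globally Lipschitz. Shrinking the time
    interval keeps its solution where [c] is the identity. *)
Lemma picard n (G : 'rV[R]_n -> 'rV[R]_n) (L r : R) y0 : 0 <= L -> 0 < r ->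
  (forall y z, `|y - y0| <= r -> `|z - y0| <= r -> `|G y - G z| <= L * `|y - z|) ->
  exists2 delta, 0 < delta & exists y : R -> 'rV[R]_n,
    y 0 = y0 /\ forall t : R, -delta < t < delta ->
      `|y t - y0| < r /\ is_derive t 1 y (G (y t)).
Proof.
move=> L0 r0 GL.
pose c (y : 'rV[R]_n) : 'rV[R]_n := \row_a clamp (y0 0 a - r) (y0 0 a + r) (y 0 a).
have cr y : `|c y - y0| <= r.
  apply: mx_norm_le; first exact: ltW.
  move=> a; rewrite !mxE ler_distl; apply: clamp_itv; lra.
have cid y : `|y - y0| <= r -> c y = y.
  move=> yr; apply/rowP => a; rewrite mxE clamp_id// -ler_distl.
  by apply: le_trans yr; have := mx_norm_ge (y - y0) a; rewrite !mxE.
have cl y z : `|c y - c z| <= `|y - z|.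
  apply: mx_norm_le => // a; rewrite !mxE; apply: le_trans (clamp_lipschitz _ _ _ _) _.
  by have := mx_norm_ge (y - z) a; rewrite !mxE.
have [y z|delta d0 [y [yy0 yd]]] := @picard_lipschitz _ (G \o c) L y0 L0.
  by apply: le_trans (GL _ _ (cr y) (cr z)) _; rewrite ler_wpM2l.
have cy : {for 0, continuous y}.
  by apply/differentiable_continuous/derivable1_diffP; have [] := yd 0; [lra|].
have [e /= e0 ye] := (nbhs_ballP _ _).1 ((cvgrPdist_lt _ _).1 cy r r0).
exists (Num.min delta e); first by rewrite lt_min d0.
exists y; split=> // t; rewrite -ltr_norml lt_min => /andP[td te].
have yr : `|y t - y0| < r.
  by rewrite distrC -yy0; apply: ye; rewrite -ball_normE/= sub0r normrN.
split=> //; have := yd t; rewrite -ltr_norml => /(_ td) /=.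
by rewrite cid// ltW.
Qed.

End Picard.

(** * Smooth curves and second-order differential equations *)

Section SmoothCurves.
Variable R : realType.
Implicit Types (n : nat) (J : set R) (c : R -> R).

(** Order 0 asks nothing, since [smooth_curve_on] only requires each iterated derivative to be
    derivable; order [k.+1] provides this for the [k]-th one. *)
Fixpoint Ck_curve k J c : Prop :=
  if k is k'.+1 then (forall t, J t -> derivable c t 1) /\ Ck_curve k' J (derive1 c)
  else True.

Lemma eq_Ck_curve k J c d : open J -> (forall t, J t -> c t = d t) ->
  Ck_curve k J c -> Ck_curve k J d.
Proof.
move=> oJ; elim: k c d => [|k IH] c d cd //= [dc Dc].
have cdn t : J t -> \near t, c t = d t.
  by move=> Jt; have := open_nbhs_nbhs (conj oJ Jt); apply: filterS.
split=> [t Jt|]; first exact: near_eq_derivable (cdn t Jt) (dc t Jt).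
by apply: IH Dc => t Jt; rewrite !derive1E; exact: near_eq_derive (cdn t Jt).
Qed.

Lemma Ck_curve_subset k J J' c : J' `<=` J -> Ck_curve k J c -> Ck_curve k J' c.
Proof.
by move=> J'J; elim: k c => [|k IH] c //= [dc Dc]; split=> [t /J'J|]; [exact: dc|exact: IH].
Qed.

Lemma Ck_curve_weaken k J c : Ck_curve k.+1 J c -> Ck_curve k J c.
Proof. by elim: k c => [|k IH] c //= [dc Dc]; split=> //; exact: IH. Qed.

Lemma Ck_curve_derivable J c k t :
  (forall k, Ck_curve k J c) -> J t -> derivable (derive1n k c) t 1.
Proof.
move=> /(_ k.+1) + Jt; elim: k c => [|k IH] c /=; first by move=> [dc _]; exact: dc.
by move=> [_ /IH]; rewrite -derive1Sn.
Qed.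

Lemma Ck_curve_cst k J (a : R) : Ck_curve k J (fun=> a).
Proof.
elim: k a => [|k IH] a //=; split=> [t _|]; first exact: derivable_cst.
by rewrite (_ : derive1 _ = fun=> 0)//; apply/funext => t; rewrite derive1_cst.
Qed.

Lemma Ck_curveD k J c d : open J -> Ck_curve k J c -> Ck_curve k J d ->
  Ck_curve k J (fun t => c t + d t).
Proof.
move=> oJ; elim: k c d => [|k IH] c d //= [dc Dc] [dd Dd]; split=> [t Jt|].
  by apply: derivableD; [exact: dc|exact: dd].
apply: (eq_Ck_curve oJ _ (IH _ _ Dc Dd)) => t Jt.
by rewrite !derive1E deriveD//; [exact: dc|exact: dd].
Qed.

Lemma Ck_curveM k J c d : open J -> Ck_curve k J c -> Ck_curve k J d ->
  Ck_curve k J (fun t => c t * d t).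
Proof.
move=> oJ; elim: k c d => [|k IH] c d // Cc Cd; have [dc Dc] := Cc; have [dd Dd] := Cd.
split=> [t Jt|].
  by apply: derivableM; [exact: dc|exact: dd].
have := Ck_curveD oJ (IH _ _ (Ck_curve_weaken Cc) Dd) (IH _ _ (Ck_curve_weaken Cd) Dc).
apply: eq_Ck_curve => // t Jt.
by rewrite !derive1E (deriveM (dc t Jt) (dd t Jt)).
Qed.

Lemma Ck_curve_sum k J m (c : 'I_m -> R -> R) : open J ->
  (forall i, Ck_curve k J (c i)) -> Ck_curve k J (fun t => \sum_i c i t).
Proof.
move=> oJ cc.
rewrite (_ : (fun x => _) = \sum_i c i); last by apply/funext => x; rewrite fct_sumE.
elim/big_ind : _ => //; first exact: Ck_curve_cst.
by move=> g h sg sh; exact: Ck_curveD.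
Qed.

Lemma derivable_rV n (x : R -> 'rV[R]_n) t :
  (forall a, derivable (fun s => x s 0 a) t 1) -> derivable x t 1.
Proof. by move=> dx; apply/derivable_mxP => i a; rewrite ord1. Qed.

Lemma is_derive_comp_curve n (W : normedModType R) (h : 'rV[R]_n -> W) (x : R -> 'rV[R]_n)
    (v : 'rV[R]_n) (t : R) :
  is_derive t 1 x v -> differentiable h (x t) ->
  is_derive t 1 (h \o x) ('D_v h (x t)).
Proof.
move=> [dx <-] dh; have dx' := (derivable1_diffP _ _).1 dx.
apply: DeriveDef; last exact: derive_comp.
exact/derivable1_diffP/(differentiable_comp dx' dh).
Qed.

Lemma Ck_curve_comp n k J (U : set 'rV[R]_n) (h : 'rV[R]_n -> R) (x : R -> 'rV[R]_n) :
  open J -> smooth_on U h -> (forall t, J t -> U (x t)) ->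
  (forall a, Ck_curve k J (fun t => x t 0 a)) -> Ck_curve k J (h \o x).
Proof.
move=> oJ; elim: k h => [|k IH] h sh JU cx //.
have dx t : J t -> derivable x t 1.
  by move=> Jt; apply: derivable_rV => a; have [dx _] := cx a; exact: dx.
have isd t : J t -> is_derive t 1 (h \o x) ('D_('D_1 x t) h (x t)).
  move=> Jt; apply: is_derive_comp_curve; first exact: derivableP (dx t Jt).
  exact: smooth_on_differentiable sh (JU t Jt).
split=> [t Jt|]; first by have [] := isd t Jt.
have : Ck_curve k J (fun t => \sum_(a < n)
    derive1 (fun s => x s 0 a) t * 'D_(delta_mx 0 a) h (x t)).
  apply: Ck_curve_sum => // a; apply: Ck_curveM => //; first by have [] := cx a.
  apply: (IH (fun y => 'D_(delta_mx 0 a) h y)) => //.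
    exact: smooth_on_derive_delta.
  by move=> b; exact: Ck_curve_weaken.
apply: eq_Ck_curve => // t Jt; rewrite derive1E; have [_ ->] := isd t Jt.
rewrite derive_sum_delta; last exact: smooth_on_differentiable sh (JU t Jt).
apply: eq_bigr => a _; rewrite derive1E derive_mx; last exact: dx.
by rewrite mxE.
Qed.

Lemma smooth_on_coord n (U : set 'rV[R]_n) a : smooth_on U (fun x => x 0 a).
Proof.
case=> [|k] /=; first by move=> x _; exact: coord_continuous.
split=> [x _|i]; first exact: differentiable_coord.
rewrite (_ : (fun x => _) = fun=> (delta_mx 0 i : 'rV[R]_n) 0 a); first exact: smooth_on_cst.
apply/funext => x; rewrite -(derive_rV (f := id)).
  by rewrite derive_id.
by [].
Qed.

(** Near [x0] the partial derivatives stay within 1 of their values at [x0]; balls being convex, the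
    mean value theorem along segments turns this into a Lipschitz bound. *)
Lemma smooth_vec_lipschitz n m (U : set 'rV[R]_n) (h : 'rV[R]_n -> 'rV[R]_m) x0 :
  open U -> smooth_vec_on U h -> U x0 ->
  exists r L, [/\ 0 < r, 0 <= L, forall y, `|y - x0| <= r -> U y &
    forall y z, `|y - x0| <= r -> `|z - x0| <= r -> `|h y - h z| <= L * `|y - z|].
Proof.
move=> oU sh Ux0.
pose P a b y := 'D_(delta_mx 0 b) (fun x => h x 0 a) y.
have cP a b : {for x0, continuous (P a b)}.
  by apply: smooth_on_continuous Ux0; exact: smooth_on_derive_delta.
have nP : \forall y \near x0, forall a b, `|P a b x0 - P a b y| <= 1.
  have H a b : \forall y \near x0, `|P a b x0 - P a b y| <= 1.
    exact: ((cvgrPdist_le _ _).1 (cP a b) _ ltr01).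
  pose f a b : set 'rV[R]_n := fun y => `|P a b x0 - P a b y| <= 1.
  pose g a : set 'rV[R]_n := fun y => forall b, f a b y.
  have H' a : nbhs x0 (g a) by exact: (@filter_forall _ _ (f a) (nbhs x0) _ (H a)).
  exact: (@filter_forall _ _ g (nbhs x0) _ H').
have [r /= r0 rP] := (nbhs_ballP _ _).1 (filterI (open_nbhs_nbhs (conj oU Ux0)) nP).
pose L := \sum_(a < m) \sum_(b < n) (`|P a b x0| + 1).
have La a : \sum_(b < n) (`|P a b x0| + 1) <= L.
  rewrite /L (bigD1 a)//= lerDl sumr_ge0// => i _; apply: sumr_ge0 => j _.
  by rewrite addr_ge0.
have L0 : 0 <= L by apply: sumr_ge0 => i _; apply: sumr_ge0 => j _; rewrite addr_ge0.
(* Halving the radius puts a closed ball inside the open one. *)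
have rP' y : `|y - x0| <= r / 2 -> U y /\ forall a b, `|P a b x0 - P a b y| <= 1.
  move=> yr; apply: rP; rewrite -ball_normE/= distrC.
  by apply: (le_lt_trans yr); rewrite ltr_pdivrMr// ltr_pMr// ltr1n.
exists (r / 2), L; split=> //; first by rewrite divr_gt0.
  by move=> y /rP'[].
move=> y z yr zr; rewrite distrC (distrC y).
apply: mx_norm_le; first by rewrite mulr_ge0.
move=> a; rewrite !mxE.
have seg s : 0 <= s <= 1 -> `|y + s *: (z - y) - x0| <= r / 2.
  move=> /andP[s0 s1].
  have -> : y + s *: (z - y) - x0 = (1 - s) *: (y - x0) + s *: (z - x0).
    by rewrite scalerBl scale1r !scalerBr; apply/rowP => i; rewrite !mxE; ring.
  apply: le_trans (ler_normD _ _) _; rewrite !normrZ !ger0_norm ?subr_ge0//.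
  have -> : r / 2 = (1 - s) * (r / 2) + s * (r / 2) by ring.
  by apply: lerD; rewrite ler_wpM2l// subr_ge0.
have dh s : 0 <= s <= 1 -> differentiable (fun x => h x 0 a) (y + s *: (z - y)).
  by move=> /seg/rP'[Us _]; exact: smooth_on_differentiable (sh a) Us.
have [s s01] := mean_value_line ltr01 dh.
rewrite scale1r subrKC mul1r => ->; rewrite derive_sum_delta; last exact: dh.
apply: (@le_trans _ _ ((\sum_(b < n) (`|P a b x0| + 1)) * `|z - y|)); last first.
  by rewrite ler_wpM2r.
apply: le_trans (ler_norm_sum _ _ _) _; rewrite mulr_suml; apply: ler_sum => b _.
rewrite normrM mulrC; apply: ler_pM => //; last exact: mx_norm_ge.
have [_ /(_ a b)] := rP' _ (seg _ s01); rewrite -/(P a b _).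
rewrite -[X in _ -> `|X| <= _](subKr (P a b x0)) => H.
by apply: le_trans (ler_normB _ _) _; rewrite lerD2l.
Qed.

(** This is the first-order system for the pair [(x, v)], encoded as [row_mx x v], with field
    [(v, A x v)]. The field is smooth over [U], hence locally Lipschitz, and the ball in which
    [picard] confines the solution keeps [x] in [U]. *)
Lemma second_order_ode n (U : set 'rV[R]_n) (Gamma : 'I_n -> 'I_n -> 'I_n -> 'rV[R]_n -> R)
    x0 v0 : open U -> (forall e a b, smooth_on U (Gamma e a b)) -> U x0 ->
  let A x v : 'rV[R]_n := \row_e \sum_a \sum_b Gamma e a b x * (v 0 a * v 0 b) in
  exists2 delta, 0 < delta & exists x v : R -> 'rV[R]_n, [/\ x 0 = x0, v 0 = v0 &
    forall t : R, -delta < t < delta ->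
      [/\ U (x t), is_derive t 1 x (v t) & is_derive t 1 v (A (x t) (v t))]].
Proof.
move=> oU sG Ux0 A.
pose W : set 'rV[R]_(n + n) := [set w | U (lsubmx w)].
pose G (w : 'rV[R]_(n + n)) := row_mx (rsubmx w) (A (lsubmx w) (rsubmx w)).
have oW : open W by apply: open_comp oU => w _; exact: continuous_lsubmx.
have sl : smooth_vec_on W lsubmx.
  move=> a; rewrite (_ : (fun x => _) = fun x : 'rV[R]_(n + n) => x 0 (lshift n a)).
    exact: smooth_on_coord.
  by apply/funext => x; rewrite mxE.
have sr a : smooth_on W (fun w => (rsubmx w) 0 a).
  rewrite (_ : (fun x => _) = fun x : 'rV[R]_(n + n) => x 0 (rshift n a)).
    exact: smooth_on_coord.
  by apply/funext => x; rewrite mxE.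
have sGW : smooth_vec_on W G.
  move=> i; case: (split_ordP i) => a ->{i}.
    by apply: (eq_smooth_on oW _ (sr a)) => w _; rewrite row_mxEl.
  pose h w := \sum_d \sum_b Gamma a d b (lsubmx w) * ((rsubmx w) 0 d * (rsubmx w) 0 b).
  apply: (@eq_smooth_on _ _ _ h) => //; first by move=> w _; rewrite row_mxEr mxE.
  do 2 (apply: smooth_on_sum => // ?); apply: smooth_onM => //.
    exact: smooth_on_comp oW _ sl (sG _ _ _).
  exact: smooth_onM.
have Ww0 : W (row_mx x0 v0) by rewrite /W /= row_mxKl.
have [r [L [r0 L0 rW GL]]] := smooth_vec_lipschitz oW sGW Ww0.
have [delta d0 [y [y0 yd]]] := picard L0 r0 GL.
exists delta => //; exists (fun t => lsubmx (y t)), (fun t => rsubmx (y t)).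
split; [by rewrite y0 row_mxKl|by rewrite y0 row_mxKr|move=> t td].
have [yr dy] := yd t td; split; first exact/rW/ltW.
- apply: is_derive_rV => a; have := is_derive_rVE (lshift n a) dy.
  rewrite /G row_mxEl.
  rewrite (_ : (fun s => y s 0 (lshift n a)) = fun s => lsubmx (y s) 0 a)//.
  by apply/funext => s; rewrite mxE.
- apply: is_derive_rV => a; have := is_derive_rVE (rshift n a) dy.
  rewrite /G row_mxEr.
  rewrite (_ : (fun s => y s 0 (rshift n a)) = fun s => rsubmx (y s) 0 a)//.
  by apply/funext => s; rewrite mxE.
Qed.

(** Bootstrapping on [x] and [v] together: the derivative of [x] is [v], and that of [v] is
    polynomial in [v] with coefficients smooth in [x], so one order of regularity yields the
    next. *)
Lemma second_order_ode_smooth n (U : set 'rV[R]_n)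
    (Gamma : 'I_n -> 'I_n -> 'I_n -> 'rV[R]_n -> R) J (x v : R -> 'rV[R]_n) :
  open J -> (forall e a b, smooth_on U (Gamma e a b)) ->
  (forall t, J t -> [/\ U (x t), is_derive t 1 x (v t) &
    is_derive t 1 v (\row_e \sum_a \sum_b Gamma e a b (x t) * (v t 0 a * v t 0 b))]) ->
  forall k a, Ck_curve k J (fun t => x t 0 a).
Proof.
move=> oJ sG xv k.
suff : (forall a, Ck_curve k J (fun t => x t 0 a)) /\
    (forall a, Ck_curve k J (fun t => v t 0 a)).
  by case.
elim: k => [|k [IHx IHv]]; first by split.
split=> a; split=> [t /xv[_ dx dv]|].
- by have [] := is_derive_rVE a dx.
- apply: (eq_Ck_curve oJ _ (IHv a)) => t /xv[_ dx dv].
  by rewrite derive1E; have [_ ->] := is_derive_rVE a dx.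
- by have [] := is_derive_rVE a dv.
- have : Ck_curve k J (fun t =>
      \sum_d \sum_b Gamma a d b (x t) * (v t 0 d * v t 0 b)).
    do 2 (apply: Ck_curve_sum => // ?); apply: Ck_curveM => //; last exact: Ck_curveM.
    by apply: Ck_curve_comp (sG _ _ _) _ IHx => // t /xv[].
  apply: eq_Ck_curve => // t /xv[_ dx dv].
  by rewrite derive1E; have [_ ->] := is_derive_rVE a dv; rewrite mxE.
Qed.

End SmoothCurves.

(** * Charts, vector fields and connections *)

Section ManifoldTheory.
Variables (R : realType) (n : nat) (N : manifold R n).
Implicit Types (i j k : chart_index N) (p q : N) (v w : 'rV[R]_n) (U : set N)
  (X Y Z : N -> 'rV[R]_n) (f : N -> R).

Lemma chart_image_chart i U p : chart_dom i p -> U p -> chart_image i U (chart i p).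
Proof. by move=> ip Up; exists p. Qed.

Lemma chart_image_subset i U U' : U `<=` U' -> chart_image i U `<=` chart_image i U'.
Proof. by move=> UU' x [p [ip /UU' Up] <-]; exists p. Qed.

Lemma chart_image_open i U : open U -> open (chart_image i U).
Proof.
move=> oU; rewrite openE => x [p [ip Up] <-].
have inbh : nbhs (chart i p) (chart i @` chart_dom i).
  by apply: open_nbhs_nbhs; split; [exact: chart_img_open|exists p].
have cinv : {for chart i p, continuous (chart_inv i)}.
  by apply: chart_inv_continuous; exists p.
have Unbh : nbhs (chart i p) (chart_inv i @^-1` U).
  by apply: cinv; rewrite chartK//; exact: open_nbhs_nbhs.
apply: filterS2 inbh Unbh => _ [q iq <-] /=; rewrite chartK// => Uq.
by exists q.
Qed.

Lemma chart_image_nbhs i U p : open U -> chart_dom i p -> U p ->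
  nbhs (chart i p) (chart_image i U).
Proof.
move=> oU ip Up; apply: open_nbhs_nbhs; split; first exact: chart_image_open.
exact: chart_image_chart.
Qed.

Lemma transition_differentiable i j p : chart_dom i p -> chart_dom j p ->
  differentiable (chart j \o chart_inv i) (chart i p).
Proof.
by move=> ip jp; apply: smooth_vec_on_differentiable (transition_smooth i j) _; exists p.
Qed.

Lemma transition_image i j U x : U `<=` chart_dom j -> chart_image i U x ->
  chart_image j U ((chart j \o chart_inv i) x).
Proof.
by move=> Uj [p [ip Up] <-]; rewrite /= chartK//; exists p => //; split=> //; exact: Uj.
Qed.

Definition dtransition i j p v : 'rV[R]_n :=
  'D_v (chart j \o chart_inv i) (chart i p).

Lemma dtransition_linear i j p (a : R) v w : chart_dom i p -> chart_dom j p ->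
  dtransition i j p (a *: v + w) = a *: dtransition i j p v + dtransition i j p w.
Proof. by move=> ip jp; apply: derive_linear; exact: transition_differentiable. Qed.

Lemma dtransition_sum i j p v : chart_dom i p -> chart_dom j p ->
  dtransition i j p v = \sum_a v 0 a *: dtransition i j p (delta_mx 0 a).
Proof. by move=> ip jp; apply: derive_sum_delta; exact: transition_differentiable. Qed.

Lemma dtransition_id i p v : chart_dom i p -> dtransition i i p v = v.
Proof.
move=> ip; rewrite /dtransition -[RHS](derive_id (chart i p) v); apply: near_eq_derive.
have := chart_image_nbhs openT ip I; apply: filterS => x [q [iq _] <-] /=.
by rewrite chartK.
Qed.

Lemma dtransition_comp i j k p v : chart_dom i p -> chart_dom j p -> chart_dom k p ->
  dtransition j k p (dtransition i j p v) = dtransition i k p v.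
Proof.
move=> ip jp kp; rewrite /dtransition.
have E : (chart j \o chart_inv i) (chart i p) = chart j p by rewrite /= chartK.
rewrite -[in LHS]E -derive_comp ?E; [|exact: transition_differentiable..].
apply: near_eq_derive.
have := chart_image_nbhs (chart_dom_open j) ip jp; apply: filterS => x [q [iq jq] <-] /=.
by rewrite !chartK.
Qed.

Lemma in_chartE i p v : in_chart i p v = dtransition (chart_at p) i p v.
Proof. by []. Qed.

(** Its components in the chart [i] are constant; [coord_field i a] is the case [w = delta_mx 0 a],
    by conversion. *)
Definition constant_field i w : N -> 'rV[R]_n := fun p => dtransition i (chart_at p) p w.

Lemma in_chart_constant_field i w p : chart_dom i p -> in_chart i p (constant_field i w p) = w.
Proof.
by move=> ip; rewrite in_chartE dtransition_comp ?dtransition_id//; exact: chart_at_dom.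
Qed.

Lemma constant_field_in_chart i v p : chart_dom i p -> constant_field i (in_chart i p v) p = v.
Proof.
by move=> ip; rewrite /constant_field dtransition_comp ?dtransition_id//; exact: chart_at_dom.
Qed.

Lemma constant_field_sum i w p : chart_dom i p ->
  constant_field i w p = \sum_a w 0 a *: coord_field i a p.
Proof. by move=> ip; apply: dtransition_sum => //; exact: chart_at_dom. Qed.

Lemma in_chart_sum i v p : chart_dom i p ->
  v = \sum_a (in_chart i p v) 0 a *: coord_field i a p.
Proof. by move=> ip; rewrite -constant_field_sum// constant_field_in_chart. Qed.

Lemma in_chart_linear i p (a : R) v w : chart_dom i p ->
  in_chart i p (a *: v + w) = a *: in_chart i p v + in_chart i p w.
Proof. by move=> ip; apply: dtransition_linear => //; exact: chart_at_dom. Qed.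

Lemma smooth_fun_on_subset U U' f : U' `<=` U -> smooth_fun_on U f -> smooth_fun_on U' f.
Proof. by move=> U'U sf i; apply: smooth_on_subset (sf i); exact: chart_image_subset. Qed.

Lemma smooth_field_on_subset U U' X : U' `<=` U -> smooth_field_on U X -> smooth_field_on U' X.
Proof. by move=> U'U sf i a; apply: smooth_on_subset (sf i a); exact: chart_image_subset. Qed.

(** The definition of smoothness quantifies over all charts; for [U] inside one chart, smooth
    transitions reduce the check to that chart. *)
Lemma smooth_fun_on_chart i U f : open U -> U `<=` chart_dom i ->
  smooth_on (chart_image i U) (f \o chart_inv i) -> smooth_fun_on U f.
Proof.
move=> oU Ui sf k; have oW : open (chart_image k U) by exact: chart_image_open.
have sT : smooth_vec_on (chart_image k U) (chart i \o chart_inv k).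
  apply: smooth_vec_on_subset (transition_smooth k i).
  by move=> x [p [kp Up] <-]; exists p => //; split=> //; exact: Ui.
apply: (eq_smooth_on oW _ (smooth_on_comp oW (@transition_image k i U ^~ Ui) sT sf)).
by move=> x [p [kp Up] <-] /=; rewrite !chartK//; exact: Ui.
Qed.

Lemma smooth_field_on_chart i U X : open U -> U `<=` chart_dom i ->
  smooth_vec_on (chart_image i U) (field_in_chart i X) -> smooth_field_on U X.
Proof.
move=> oU Ui sX k b; have oW : open (chart_image k U) by exact: chart_image_open.
have oWi : open (chart_image i U) by exact: chart_image_open.
have sT : smooth_vec_on (chart_image k U) (chart i \o chart_inv k).
  apply: smooth_vec_on_subset (transition_smooth k i).
  by move=> x [p [kp Up] <-]; exists p => //; split=> //; exact: Ui.
pose Y := [set p | U p /\ chart_dom k p].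
have oY : open Y by apply: openI => //; exact: chart_dom_open.
have sT' : smooth_vec_on (chart_image i Y) (chart k \o chart_inv i).
  apply: smooth_vec_on_subset (transition_smooth i k).
  by move=> x [p [ip [Up kp]] <-]; exists p.
have WY x : chart_image k U x -> chart_image i Y ((chart i \o chart_inv k) x).
  by move=> [p [kp Up] <-]; rewrite /= chartK//; exists p => //; split=> //; exact: Ui.
(* These are the entries of the Jacobian of the change of chart from [i] to [k]; the components of
   [X] in [k] are those in [i] multiplied by it. *)
pose T a := 'D_(delta_mx 0 a) (fun z => (chart k \o chart_inv i) z 0 b).
have sDT a : smooth_on (chart_image i Y) (T a) by exact: smooth_on_derive_delta.
have : smooth_on (chart_image k U) (fun x => \sum_a
    ((fun z => field_in_chart i X z 0 a) \o (chart i \o chart_inv k)) x *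
    (T a \o (chart i \o chart_inv k)) x).
  apply: smooth_on_sum => // a; apply: smooth_onM => //.
    exact: (smooth_on_comp oW (@transition_image k i U ^~ Ui) sT (sX a)).
  exact: (smooth_on_comp oW WY sT (sDT a)).
apply: eq_smooth_on => // _ [p [kp Up] <-] /=; have ip := Ui _ Up.
rewrite /field_in_chart !chartK//.
have -> : in_chart k p (X p) = dtransition i k p (in_chart i p (X p)).
  by rewrite [in RHS]in_chartE dtransition_comp//; exact: chart_at_dom.
rewrite (dtransition_sum _ ip kp) summxE; apply: eq_bigr => a _.
by rewrite mxE /T -derive_rV//; exact: transition_differentiable.
Qed.

Lemma constant_field_smooth i w : smooth_field_on (chart_dom i) (constant_field i w).
Proof.
apply: (smooth_field_on_chart (chart_dom_open i) (@subset_refl _ _)) => a.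
apply: (eq_smooth_on (chart_image_open (chart_dom_open i)) _ (smooth_on_cst _ (w 0 a))).
by move=> x [p [ip _] <-]; rewrite /field_in_chart chartK// in_chart_constant_field.
Qed.

Lemma constant_field_near i w p : chart_dom i p -> smooth_field_near p (constant_field i w).
Proof.
by move=> ip; exists (chart_dom i); split=> //; [exact: chart_dom_open|exact: constant_field_smooth].
Qed.

Lemma coord_field_near i a p : chart_dom i p -> smooth_field_near p (coord_field i a).
Proof. exact: constant_field_near. Qed.

Lemma smooth_fun_near_differentiable i p f : chart_dom i p -> smooth_fun_near p f ->
  differentiable (f \o chart_inv i) (chart i p).
Proof.
by move=> ip [U [oU Up sf]]; apply: smooth_on_differentiable (sf i) _; exact: chart_image_chart.
Qed.

Lemma deriv_along_chart i p v f : chart_dom i p -> smooth_fun_near p f ->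
  deriv_along p v f = 'D_(in_chart i p v) (f \o chart_inv i) (chart i p).
Proof.
move=> ip sf; have df := smooth_fun_near_differentiable ip sf.
have ap := chart_at_dom p.
have E : (chart i \o chart_inv (chart_at p)) (chart (chart_at p) p) = chart i p by rewrite /= chartK.
rewrite /in_chart -[in RHS]E -derive_comp ?E//; last exact: transition_differentiable.
apply: near_eq_derive.
have := chart_image_nbhs (chart_dom_open i) ap ip; apply: filterS => x [q [aq iq] <-] /=.
by rewrite !chartK.
Qed.

Lemma smooth_field_onD U X Y : open U -> smooth_field_on U X -> smooth_field_on U Y ->
  smooth_field_on U (fun q => X q + Y q).
Proof.
move=> oU sX sY i a; have oW : open (chart_image i U) by exact: chart_image_open.
apply: (eq_smooth_on oW _ (smooth_onD oW (sX i a) (sY i a))) => _ [p [ip Up] <-].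
rewrite /field_in_chart chartK// -[X p]scale1r in_chart_linear// !scale1r.
by rewrite mxE.
Qed.

Lemma smooth_field_onZ U f X : open U -> smooth_fun_on U f -> smooth_field_on U X ->
  smooth_field_on U (fun q => f q *: X q).
Proof.
move=> oU sf sX i a; have oW : open (chart_image i U) by exact: chart_image_open.
apply: (eq_smooth_on oW _ (smooth_onM oW (sf i) (sX i a))) => _ [p [ip Up] <-] /=.
rewrite /field_in_chart chartK// -[f p *: X p]addr0 in_chart_linear//.
have -> : in_chart i p 0 = 0 by exact: derive0.
by rewrite addr0 mxE.
Qed.

Lemma smooth_field_on0 U : open U -> smooth_field_on U (fun=> 0).
Proof.
move=> oU i a; apply: (eq_smooth_on (chart_image_open oU) _ (smooth_on_cst _ 0)) => x _.
by rewrite /field_in_chart /in_chart derive0 mxE.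
Qed.

Lemma smooth_field_nearD p X Y : smooth_field_near p X -> smooth_field_near p Y ->
  smooth_field_near p (fun q => X q + Y q).
Proof.
move=> [U [oU Up sX]] [U' [oU' Up' sY]]; exists (U `&` U').
split; [exact: openI|by split|].
apply: smooth_field_onD; [exact: openI|exact: smooth_field_on_subset sX|
  by apply: smooth_field_on_subset sY => x []].
Qed.

Lemma smooth_field_nearZ p f X : smooth_fun_near p f -> smooth_field_near p X ->
  smooth_field_near p (fun q => f q *: X q).
Proof.
move=> [U [oU Up sX]] [U' [oU' Up' sY]]; exists (U `&` U').
split; [exact: openI|by split|].
apply: smooth_field_onZ; [exact: openI|exact: smooth_fun_on_subset sX|
  by apply: smooth_field_on_subset sY => x []].
Qed.

Lemma smooth_field_near_sum p m (Y : 'I_m -> N -> 'rV[R]_n) :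
  (forall a, smooth_field_near p (Y a)) -> smooth_field_near p (fun q => \sum_a Y a q).
Proof.
elim: m Y => [|m IH] Y sY.
  rewrite (_ : (fun q => _) = fun=> 0); last by apply/funext => q; rewrite big_ord0.
  by exists setT; split=> //; [exact: openT|exact: smooth_field_on0 openT].
rewrite (_ : (fun q => _) = fun q => \sum_(a < m) Y (widen_ord (leqnSn m) a) q + Y ord_max q).
  by apply: smooth_field_nearD => //; exact: IH.
by apply/funext => q; rewrite big_ord_recr.
Qed.

Section Metric.
Variable g : riemannian_metric N.

Lemma metricDl p v v' w : g p (v + v') w = g p v w + g p v' w.
Proof. by rewrite -[v]scale1r metric_linear mul1r scale1r. Qed.

Lemma metricDr p v w w' : g p v (w + w') = g p v w + g p v w'.
Proof. by rewrite Defs.metric_sym metricDl !(Defs.metric_sym _ _ v). Qed.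

Lemma metric0l p w : g p 0 w = 0.
Proof. by apply: (addrI (g p 0 w)); rewrite -metricDl !addr0. Qed.

Lemma metric0r p w : g p w 0 = 0.
Proof. by rewrite Defs.metric_sym metric0l. Qed.

Lemma metricZl p (a : R) v w : g p (a *: v) w = a * g p v w.
Proof. by rewrite -[a *: v]addr0 metric_linear metric0l addr0. Qed.

Lemma metricZr p (a : R) v w : g p v (a *: w) = a * g p v w.
Proof. by rewrite Defs.metric_sym metricZl Defs.metric_sym. Qed.

Lemma metricNl p v w : g p (- v) w = - g p v w.
Proof. by rewrite -scaleN1r metricZl mulN1r. Qed.

Lemma metricNr p v w : g p v (- w) = - g p v w.
Proof. by rewrite Defs.metric_sym metricNl Defs.metric_sym. Qed.

Lemma metricBl p v v' w : g p (v - v') w = g p v w - g p v' w.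
Proof. by rewrite metricDl metricNl. Qed.

Lemma metricBr p v w w' : g p v (w - w') = g p v w - g p v w'.
Proof. by rewrite metricDr metricNr. Qed.

Lemma metric_suml p m (v : 'I_m -> 'rV[R]_n) w :
  g p (\sum_a v a) w = \sum_a g p (v a) w.
Proof.
elim/big_ind2 : _ => [|x a y b <- <-|//]; [exact: metric0l|exact: metricDl].
Qed.

Lemma metric_sumr p m (v : 'I_m -> 'rV[R]_n) w :
  g p w (\sum_a v a) = \sum_a g p w (v a).
Proof. by rewrite Defs.metric_sym metric_suml; apply: eq_bigr => a _; rewrite Defs.metric_sym. Qed.

Lemma metric_ge0 p v : 0 <= g p v v.
Proof.
have [->|v0] := eqVneq v 0; first by rewrite metric0l.
exact/ltW/metric_pos.
Qed.

Lemma metric_eq0 p v : (g p v v == 0) = (v == 0).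
Proof.
have [->|v0] := eqVneq v 0; first by rewrite metric0l eqxx.
by rewrite gt_eqF//; exact: metric_pos.
Qed.

Lemma smooth_metric U X Y : open U -> smooth_field_on U X -> smooth_field_on U Y ->
  smooth_fun_on U (fun q => g q (X q) (Y q)).
Proof.
move=> oU sX sY i; have oW : open (chart_image i U) by exact: chart_image_open.
have : smooth_on (chart_image i U) (fun x => \sum_a \sum_b
    (field_in_chart i X x 0 a * field_in_chart i Y x 0 b) *
    g (chart_inv i x) (coord_field i a (chart_inv i x)) (coord_field i b (chart_inv i x))).
  do 2 (apply: smooth_on_sum => // ?); apply: smooth_onM => //.
    by apply: smooth_onM => //; [exact: sX|exact: sY].
  by apply: smooth_on_subset (metric_smooth g _ _ _); exact: chart_image_subset.
apply: eq_smooth_on => // _ [p [ip Up] <-] /=.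
rewrite /field_in_chart chartK//.
rewrite [in RHS](in_chart_sum (X p) ip) [in RHS](in_chart_sum (Y p) ip) metric_suml.
apply: eq_bigr => a _; rewrite metricZl metric_sumr mulr_sumr.
by apply: eq_bigr => b _; rewrite metricZr mulrA.
Qed.

Lemma smooth_metric_near p X Y : smooth_field_near p X -> smooth_field_near p Y ->
  smooth_fun_near p (fun q => g q (X q) (Y q)).
Proof.
move=> [U [oU Up sX]] [U' [oU' Up' sY]]; exists (U `&` U').
split; [exact: openI|by split|].
apply: smooth_metric; [exact: openI|exact: smooth_field_on_subset sX|
  by apply: smooth_field_on_subset sY => x []].
Qed.

Section Connection.
Variable nabla : N -> 'rV[R]_n -> (N -> 'rV[R]_n) -> 'rV[R]_n.
Hypothesis hnabla : levi_civita g nabla.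

Lemma nabla_local U p v X Y : open U -> U p -> (forall q, U q -> X q = Y q) ->
  smooth_field_near p X -> smooth_field_near p Y -> nabla p v X = nabla p v Y.
Proof.
move=> oU Up XY sX sY.
pose chi (q : N) : R := if `[< U q >] then 1 else 0.
have chi1 q : U q -> chi q = 1 by move=> Uq; rewrite /chi asboolT.
have schi : smooth_fun_near p chi.
  exists U; split=> // i.
  apply: (eq_smooth_on (chart_image_open oU) _ (smooth_on_cst _ 1)).
  by move=> _ [q [iq Uq] <-] /=; rewrite chartK// chi1.
have E : (fun q => chi q *: X q) = (fun q => chi q *: Y q).
  apply/funext => q; rewrite /chi; case: asboolP => [Uq|_]; last by rewrite !scale0r.
  by rewrite XY.
(* The derivative of [chi] need not be computed: it multiplies [X p] in one expansion and the equal
   vector [Y p] in the other. *)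
have := nabla_leibniz hnabla v schi sX.
rewrite E (nabla_leibniz hnabla v schi sY) chi1// !scale1r XY//.
by move/addrI => ->.
Qed.

Lemma nablaDl p v w Y : smooth_field_near p Y ->
  nabla p (v + w) Y = nabla p v Y + nabla p w Y.
Proof. by move=> sY; rewrite -[v]scale1r (nabla_linear hnabla)// !scale1r. Qed.

Lemma nabla0l p Y : smooth_field_near p Y -> nabla p 0 Y = 0.
Proof. by move=> sY; apply: (addrI (nabla p 0 Y)); rewrite -nablaDl// !addr0. Qed.

Lemma nablaZl p (a : R) v Y : smooth_field_near p Y -> nabla p (a *: v) Y = a *: nabla p v Y.
Proof. by move=> sY; rewrite -[a *: v]addr0 (nabla_linear hnabla)// nabla0l// addr0. Qed.

Lemma nabla_suml p m (v : 'I_m -> 'rV[R]_n) Y : smooth_field_near p Y ->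
  nabla p (\sum_a v a) Y = \sum_a nabla p (v a) Y.
Proof.
move=> sY; elim/big_ind2 : _ => [|x a y b <- <-|//]; [exact: nabla0l|exact: nablaDl].
Qed.

Lemma nabla_sum p v m (f : 'I_m -> N -> R) (Y : 'I_m -> N -> 'rV[R]_n) :
  (forall a, smooth_fun_near p (f a)) -> (forall a, smooth_field_near p (Y a)) ->
  nabla p v (fun q => \sum_a f a q *: Y a q) =
  \sum_a (deriv_along p v (f a) *: Y a p + f a p *: nabla p v (Y a)).
Proof.
elim: m f Y => [|m IH] f Y sf sY.
  have s0 : smooth_field_near p (fun=> 0).
    by exists setT; split=> //; [exact: openT|exact: smooth_field_on0 openT].
  rewrite big_ord0 (_ : (fun q => _) = fun=> 0); last first.
    by apply/funext => q; rewrite big_ord0.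
  have := nabla_add hnabla v s0 s0.
  rewrite (_ : (fun q => 0 + 0) = (fun=> 0)); last by apply/funext => q; rewrite addr0.
  by move=> E; apply: (addrI (nabla p v (fun=> 0))); rewrite -E addr0.
rewrite big_ord_recr/= -IH// -(nabla_leibniz hnabla)// -(nabla_add hnabla).
- by congr nabla; apply/funext => q; rewrite big_ord_recr.
- by apply: smooth_field_near_sum => a; exact: smooth_field_nearZ.
- exact: smooth_field_nearZ.
Qed.

End Connection.
End Metric.
End ManifoldTheory.

(** * Geodesics *)

Section Geodesics.
Variables (R : realType) (n : nat) (N : manifold R n).
Implicit Types (i j k : chart_index N) (p q : N) (v w : 'rV[R]_n) (U : set N)
  (X Y Z : N -> 'rV[R]_n) (f : N -> R) (J : set R) (beta : R -> N).

Lemma curve_near_dom beta (t : R) U : open U -> {for t, continuous beta} -> U (beta t) ->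
  \forall s \near t, U (beta s).
Proof. by move=> oU cb Ub; apply: cb; exact: open_nbhs_nbhs. Qed.

Lemma smooth_curve_derivable J beta j t : smooth_curve_on J beta -> J t ->
  chart_dom j (beta t) -> derivable (fun s => chart j (beta s)) t 1.
Proof.
by move=> sb Jt jt; apply: derivable_rV => a; have [_ /(_ j jt a 0%N)] := sb t Jt.
Qed.

Lemma in_chart_velocity J beta j t : smooth_curve_on J beta -> J t ->
  chart_dom j (beta t) ->
  in_chart j (beta t) (velocity beta t) = derive1 (fun s => chart j (beta s)) t.
Proof.
move=> sb Jt jt; have ap := chart_at_dom (beta t); set i := chart_at (beta t) in ap *.
rewrite /in_chart /velocity -/i !derive1E.
have dx := smooth_curve_derivable sb Jt ap.
rewrite -(@derive_comp _ _ _ _ (fun s => chart i (beta s)) (chart j \o chart_inv i)).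
- apply: near_eq_derive; have [cb _] := sb t Jt.
  have := curve_near_dom (chart_dom_open i) cb ap; apply: filterS => s is_ /=.
  by rewrite chartK.
- exact/derivable1_diffP.
- exact: transition_differentiable.
Qed.

Lemma smooth_curve_comp J beta t f : smooth_curve_on J beta -> J t ->
  smooth_fun_near (beta t) f ->
  is_derive t 1 (f \o beta) (deriv_along (beta t) (velocity beta t) f).
Proof.
move=> sb Jt sf; set j := chart_at (beta t); have ap := chart_at_dom (beta t).
have dx := smooth_curve_derivable sb Jt ap.
have df := smooth_fun_near_differentiable ap sf.
have := is_derive_comp_curve (derivableP dx) df.
rewrite /deriv_along /velocity derive1E; apply: near_eq_is_derive.
have [cb _] := sb t Jt; have := curve_near_dom (chart_dom_open j) cb ap.
by apply: filterS => s js /=; rewrite chartK.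
Qed.

Section Connection.
Variables (g : riemannian_metric N) (nabla : N -> 'rV[R]_n -> (N -> 'rV[R]_n) -> 'rV[R]_n).
Hypothesis hnabla : levi_civita g nabla.

Section AlongGeodesic.
Variables (J : set R) (beta : R -> N) (t : R).
Hypotheses (geo : geodesic_on nabla J beta) (Jt : J t).
Let p := beta t.
Let j := chart_at p.
Let vel := velocity beta t.
Let x (s : R) := chart j (beta s).

Let sb : smooth_curve_on J beta. Proof. by case: geo. Qed.
Let oJ : open J. Proof. by case: geo. Qed.
Let jp : chart_dom j p. Proof. exact: chart_at_dom. Qed.

Let near_J : \forall s \near t, J s /\ chart_dom j (beta s).
Proof.
apply: filterI; first exact: open_nbhs_nbhs.
by apply: curve_near_dom => //; [exact: chart_dom_open|have [] := sb Jt].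
Qed.

Let velE s : J s -> chart_dom j (beta s) -> in_chart j (beta s) (velocity beta s) = derive1 x s.
Proof. exact: in_chart_velocity. Qed.

Let u (s : R) := derive1 x s.

Let uE s a : J s -> chart_dom j (beta s) -> u s 0 a = derive1 (fun r => x r 0 a) s.
Proof.
move=> Js js; have dx := smooth_curve_derivable sb Js js.
by rewrite /u !derive1E derive_mx// mxE.
Qed.

Let du a : derivable (fun s => u s 0 a) t 1.
Proof.
have [_ /(_ j jp a 1%N)] := sb Jt; rewrite derive1n1; apply: near_eq_derivable.
by apply: filterS near_J => s [Js js]; rewrite uE.
Qed.

Let ut : u t = vel.
Proof. by rewrite /u -velE// in_chartE dtransition_id. Qed.

Let coord_p a : coord_field j a p = delta_mx 0 a.
Proof. exact: dtransition_id. Qed.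

Let acc : \row_a 'D_1 (fun s => u s 0 a) t + \sum_a vel 0 a *: nabla p vel (coord_field j a) = 0.
Proof.
have [_ _ _ /(_ t Jt)] := geo; rewrite /covariant_deriv_along -/j => E.
rewrite -[RHS]E; apply: (congr2 +%R).
  rewrite derive1E; have du' : derivable u t 1 by apply: derivable_rV => a; exact: du.
  transitivity ('D_1 u t); first by rewrite derive_mx//; apply/rowP => a; rewrite !mxE.
  by apply: near_eq_derive; apply: filterS near_J => s [Js js]; rewrite velE.
by apply: eq_bigr => a _; rewrite velE// -ut.
Qed.

(** The velocity is a field along the curve only, so [nabla_metric] does not apply to it. It is
    expanded in coordinate fields, whose products with [Y] are functions on [N]. *)
Lemma derive_metric_velocity Y : smooth_field_near p Y ->
  is_derive t 1 (fun s => g (beta s) (velocity beta s) (Y (beta s)))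
    (g p vel (nabla p vel Y)).
Proof.
move=> sY.
pose th a q := g q (coord_field j a q) (Y q).
have sth a : smooth_fun_near p (th a).
  exact: (smooth_metric_near _ (coord_field_near a jp) sY).
have dth a := smooth_curve_comp sb Jt (sth a).
have dsum : is_derive t 1 (\sum_a ((fun s => u s 0 a) * (th a \o beta)))
    (\sum_a (u t 0 a *: deriv_along p vel (th a) + th a p *: 'D_1 (fun s => u s 0 a) t)).
  apply: is_derive_sum => a; exact: (is_deriveM (derivableP (@du a)) (dth a)).
(* The geodesic equation paired with [Y p] trades the second derivatives of the coordinates for
   connection terms; metric compatibility cancels these against part of the derivative of [th a]. *)
have -> : g p vel (nabla p vel Y) =
    \sum_a (u t 0 a *: deriv_along p vel (th a) + th a p *: 'D_1 (fun s => u s 0 a) t).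
  have := congr1 (fun w => g p w (Y p)) acc; rewrite /= metric0l metricDl metric_suml => acc0.
  rewrite -[LHS]add0r -[X in X + _ = _]acc0.
  have -> : g p (\row_a 'D_1 (fun s => u s 0 a) t) (Y p) =
      \sum_a th a p *: 'D_1 (fun s => u s 0 a) t.
    rewrite (row_sum_delta (\row_a _)) metric_suml; apply: eq_bigr => a _.
    by rewrite metricZl mxE /th coord_p mulrC.
  rewrite [RHS]big_split/= [RHS]addrC -addrA; congr (_ + _).
  have -> : g p vel (nabla p vel Y) = \sum_a g p (vel 0 a *: coord_field j a p) (nabla p vel Y).
    rewrite -metric_suml; congr (g p _ _).
    by rewrite {1}(row_sum_delta vel); apply: eq_bigr => a _; rewrite coord_p.
  rewrite -big_split/=; apply: eq_bigr => a _.
  rewrite ut (nabla_metric hnabla vel (coord_field_near a jp) sY).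
  by rewrite !metricZl scalerDr.
apply: near_eq_is_derive dsum; apply: filterS near_J => s [Js js].
rewrite fct_sumE [in RHS](in_chart_sum (velocity beta s) js) metric_suml.
by apply: eq_bigr => a _; rewrite /= metricZl velE.
Qed.

(** Only one of the two velocities is expanded in coordinate fields; products of the other with a
    coordinate field are covered by [derive_metric_velocity]. The resulting sum is the geodesic
    equation paired with [vel]. *)
Lemma derive_speed : is_derive t 1 (fun s => g (beta s) (velocity beta s) (velocity beta s)) 0.
Proof.
have d1 a := derive_metric_velocity (coord_field_near a jp).
have dsum : is_derive t 1
    (\sum_a ((fun s => u s 0 a) *
      (fun s => g (beta s) (velocity beta s) (coord_field j a (beta s)))))
    (\sum_a (u t 0 a *: g p vel (nabla p vel (coord_field j a)) +
      g p vel (coord_field j a p) *: 'D_1 (fun s => u s 0 a) t)).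
  apply: is_derive_sum => a; exact: (is_deriveM (derivableP (@du a)) (d1 a)).
have -> : (0 : R) = \sum_a (u t 0 a *: g p vel (nabla p vel (coord_field j a)) +
      g p vel (coord_field j a p) *: 'D_1 (fun s => u s 0 a) t).
  have := congr1 (g p vel) acc; rewrite metric0r metricDr metric_sumr => acc0.
  rewrite -[LHS]acc0.
  rewrite (row_sum_delta (\row_a _)) metric_sumr -big_split/=; apply: eq_bigr => a _.
  by rewrite metricZr mxE metricZr coord_p ut addrC; congr (_ + _); exact: mulrC.
apply: near_eq_is_derive dsum; apply: filterS near_J => s [Js js].
rewrite fct_sumE.
transitivity (g (beta s) (\sum_a u s 0 a *: coord_field j a (beta s)) (velocity beta s)).
  rewrite metric_suml; apply: eq_bigr => a _; rewrite /= metricZl.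
  by congr (_ * _); exact: Defs.metric_sym.
by rewrite /u -velE// -in_chart_sum.
Qed.

End AlongGeodesic.
End Connection.
End Geodesics.

(** * Christoffel symbols and invariance of the acceleration *)

Section Acceleration.
Variables (R : realType) (n : nat) (N : manifold R n).
Variables (g : riemannian_metric N) (nabla : N -> 'rV[R]_n -> (N -> 'rV[R]_n) -> 'rV[R]_n).
Hypothesis hnabla : levi_civita g nabla.
Implicit Types (i j k : chart_index N) (p q : N) (v w : 'rV[R]_n) (J : set R).

(** The symbol with upper index [e], direction [a] and differentiated field [b], as a function of
    the coordinates in [i], which is the form that the differential equation takes. *)
Definition christoffel i (e a b : 'I_n) (x : 'rV[R]_n) : R :=
  field_in_chart i (fun q => nabla q (coord_field i a q) (coord_field i b)) x 0 e.

Lemma christoffel_smooth i e a b :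
  smooth_on (chart_image i (chart_dom i)) (christoffel i e a b).
Proof.
apply: (nabla_smooth hnabla (chart_dom_open i)); exact: constant_field_smooth.
Qed.

Lemma nabla_coord_field i p (u : 'rV[R]_n) b : chart_dom i p ->
  nabla p (constant_field i u p) (coord_field i b) =
  \sum_e (\sum_a u 0 a * christoffel i e a b (chart i p)) *: coord_field i e p.
Proof.
move=> ip; have sb := coord_field_near b ip.
rewrite constant_field_sum// (nabla_suml hnabla _ sb).
under [RHS]eq_bigr do rewrite scaler_suml.
rewrite exchange_big/=; apply: eq_bigr => a _.
rewrite (nablaZl hnabla _ _ sb) [X in _ *: X = _](in_chart_sum _ ip) scaler_sumr.
by apply: eq_bigr => e _; rewrite scalerA /christoffel /field_in_chart chartK.
Qed.

(* The acceleration, read in the chart [i], of a curve through [p] whose components in [i]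
   have first derivative [u] and second derivative [a]. *)
Definition chart_acceleration i p (u a : 'rV[R]_n) : 'rV[R]_n :=
  constant_field i a p + \sum_b u 0 b *: nabla p (constant_field i u p) (coord_field i b).

Lemma chart_acceleration_christoffel i p (u : 'rV[R]_n) : chart_dom i p ->
  chart_acceleration i p u
    (\row_e \sum_a \sum_b - christoffel i e a b (chart i p) * (u 0 a * u 0 b)) = 0.
Proof.
move=> ip; rewrite /chart_acceleration constant_field_sum//.
under [X in _ + X]eq_bigr do rewrite nabla_coord_field// scaler_sumr.
rewrite [X in _ + X]exchange_big -big_split big1//= => e _.
rewrite mxE; under [X in _ + X]eq_bigr do rewrite scalerA.
rewrite -scaler_suml -scalerDl exchange_big -big_split big1 ?scale0r//= => b _.
by rewrite mulr_sumr -big_split big1//= => a _; ring.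
Qed.

Section ChangeOfChart.
Variables (i j : chart_index N).

Let T (b e : 'I_n) (x : 'rV[R]_n) := 'D_(delta_mx 0 b) (fun z => (chart j \o chart_inv i) z 0 e) x.

Let T_smooth b e : smooth_on (chart_image i (chart_dom j)) (T b e).
Proof. exact: (smooth_on_derive_delta _ (@transition_smooth _ _ N i j e)). Qed.

Let dtransition_coord p (u : 'rV[R]_n) e : chart_dom i p -> chart_dom j p ->
  dtransition i j p u 0 e = \sum_b u 0 b * T b e (chart i p).
Proof.
move=> ip jp; rewrite dtransition_sum// summxE; apply: eq_bigr => b _.
by rewrite mxE /T -derive_rV//; exact: transition_differentiable.
Qed.

Lemma constant_field_transition p (u : 'rV[R]_n) : chart_dom i p -> chart_dom j p ->
  constant_field i u p = constant_field j (dtransition i j p u) p.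
Proof. by move=> ip jp; rewrite /constant_field dtransition_comp//; exact: chart_at_dom. Qed.

Let coord_field_transition p b : chart_dom i p -> chart_dom j p ->
  coord_field i b p = \sum_e T b e (chart i p) *: coord_field j e p.
Proof.
move=> ip jp; rewrite -[LHS]/(constant_field i (delta_mx 0 b) p).
rewrite constant_field_transition// constant_field_sum//; apply: eq_bigr => e _.
by rewrite /T -derive_rV//; exact: transition_differentiable.
Qed.

Let T_near p b e : chart_dom i p -> chart_dom j p -> smooth_fun_near p (T b e \o chart i).
Proof.
move=> ip jp; have oij : open (chart_dom i `&` chart_dom j).
  by apply: openI; exact: chart_dom_open.
exists (chart_dom i `&` chart_dom j); split=> //.
apply: (smooth_fun_on_chart (i := i) oij (@subIsetl _ _ _)).
have : smooth_on (chart_image i (chart_dom i `&` chart_dom j)) (T b e).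
  by apply: smooth_on_subset (T_smooth b e); apply: chart_image_subset => ? [].
apply: eq_smooth_on; first exact: chart_image_open.
by move=> _ [q [iq _] <-] /=; rewrite chartK.
Qed.

Let nabla_coord_transition p v b : chart_dom i p -> chart_dom j p ->
  nabla p v (coord_field i b) =
  \sum_e ('D_(in_chart i p v) (T b e) (chart i p) *: coord_field j e p +
          T b e (chart i p) *: nabla p v (coord_field j e)).
Proof.
move=> ip jp.
have sT e := T_near b e ip jp; have sj e := coord_field_near e jp.
have -> : nabla p v (coord_field i b) =
    nabla p v (fun q => \sum_e (T b e \o chart i) q *: coord_field j e q).
  apply: (nabla_local hnabla v (U := chart_dom i `&` chart_dom j)) => //.
  - by apply: openI; exact: chart_dom_open.
  - by move=> q [iq jq]; exact: coord_field_transition.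
  - exact: coord_field_near.
  - by apply: smooth_field_near_sum => e; exact: smooth_field_nearZ.
rewrite (nabla_sum hnabla v sT sj); apply: eq_bigr => e _.
suff -> : deriv_along p v (T b e \o chart i) = 'D_(in_chart i p v) (T b e) (chart i p) by [].
rewrite (deriv_along_chart v ip (sT e)); apply: near_eq_derive.
have := chart_image_nbhs openT ip I; apply: filterS => _ [q [iq _] <-] /=.
by rewrite chartK.
Qed.

(** Needed because the geodesic equation is solved in a single chart while [geodesic_on] tests it in
    [chart_at (beta t)] at each time. *)
Lemma chart_acceleration_transition p (x u : R -> 'rV[R]_n) (a : 'rV[R]_n) (t : R) :
  chart_dom i p -> chart_dom j p -> x t = chart i p ->
  is_derive t 1 x (u t) -> is_derive t 1 u a ->
  exists2 a', is_derive t 1 (fun s => 'D_(u s) (chart j \o chart_inv i) (x s)) a' &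
    chart_acceleration j p (dtransition i j p (u t)) a' = chart_acceleration i p (u t) a.
Proof.
move=> ip jp xt dx du.
pose a' : 'rV[R]_n := \row_e \sum_b
  (u t 0 b *: 'D_(u t) (T b e) (x t) + T b e (x t) *: a 0 b).
exists a'.
  apply: is_derive_rV => e.
  have dT b : differentiable (T b e) (x t).
    rewrite xt; apply: smooth_on_differentiable (T_smooth b e) _.
    exact: chart_image_chart.
  have dsum : is_derive t 1 (\sum_b ((fun s => u s 0 b) * (T b e \o x))) (a' 0 e).
    rewrite mxE; apply: is_derive_sum => b.
    exact: (is_deriveM (is_derive_rVE b du) (is_derive_comp_curve dx (dT b))).
  apply: near_eq_is_derive dsum.
  have cx : {for t, continuous x}.
    by apply/differentiable_continuous/derivable1_diffP; case: dx.
  have : \forall s \near t, chart_image i (chart_dom j) (x s).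
    apply: cx; rewrite xt; apply: chart_image_nbhs => //; exact: chart_dom_open.
  apply: filterS => s [q [iq jq] xs].
  rewrite fct_sumE -xs -[RHS]/(dtransition i j q (u s) 0 e) dtransition_coord//.
  by apply: eq_bigr => b _; rewrite /= xs.
have T_in v : in_chart i p (constant_field i v p) = v by exact: in_chart_constant_field.
rewrite /chart_acceleration -(constant_field_transition _ ip jp).
set v := constant_field i (u t) p.
(* Both sides expand to this sum. The second derivatives of the change of chart come from [a'] on
   one side, and on the other from the Leibniz rule for [coord_field i b] written in the chart
   [j]. *)
transitivity (\sum_b \sum_e
    ((u t 0 b * 'D_(u t) (T b e) (chart i p) + T b e (chart i p) * a 0 b) *: coord_field j e p
     + (u t 0 b * T b e (chart i p)) *: nabla p v (coord_field j e))).
  rewrite exchange_big (constant_field_sum _ jp) -big_split; apply: eq_bigr => e _.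
  rewrite mxE (dtransition_coord _ _ ip jp) !scaler_suml -big_split; apply: eq_bigr => b _.
  by rewrite xt.
rewrite (constant_field_sum _ ip) -big_split; apply: eq_bigr => b _.
rewrite (coord_field_transition _ ip jp) (nabla_coord_transition _ _ ip jp) T_in !scaler_sumr.
rewrite -big_split; apply: eq_bigr => e _.
by rewrite /= scalerDr scalerDl !scalerA [_ * a 0 b]mulrC addrCA addrA.
Qed.

End ChangeOfChart.
End Acceleration.

(** * Local existence of geodesics *)

Section LocalGeodesics.
Variables (R : realType) (n : nat) (N : manifold R n).
Variables (g : riemannian_metric N) (nabla : N -> 'rV[R]_n -> (N -> 'rV[R]_n) -> 'rV[R]_n).
Hypothesis hnabla : levi_civita g nabla.

Lemma geodesic_exists (q : N) (v0 : 'rV[R]_n) :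
  exists (J : set R) (beta : R -> N),
    [/\ geodesic_on nabla J beta, J 0, beta 0 = q & velocity beta 0 = v0].
Proof.
set i := chart_at q; have iq : chart_dom i q by exact: chart_at_dom.
pose U := chart_image i (chart_dom i).
have oU : open U by apply: chart_image_open; exact: chart_dom_open.
(* The sign comes from moving the Christoffel terms of the geodesic equation to the right-hand
   side. *)
pose Gamma e a b x := - christoffel nabla i e a b x.
have sG e a b : smooth_on U (Gamma e a b).
  have := smooth_onZ (-1) oU (christoffel_smooth hnabla i e a b).
  by apply: eq_smooth_on => // x _; rewrite mulN1r.
have Uq : U (chart i q) by exact: chart_image_chart.
have [delta d0 [x [v [x0 v0' xv]]]] := second_order_ode v0 oU sG Uq.
pose J : set R := `]- delta, delta[%classic.
have JE t : J t <-> - delta < t < delta by rewrite /J /= in_itv.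
have oJ : open J by exact: interval_open.
have J0 : J 0 by apply/JE; rewrite oppr_lt0 d0.
pose beta t := chart_inv i (x t).
have UJ t : J t -> U (x t) by move=> /JE /xv[].
have dx t : J t -> is_derive t 1 x (v t) by move=> /JE /xv[].
have dv t : J t -> is_derive t 1 v (\row_e \sum_a \sum_b Gamma e a b (x t) * (v t 0 a * v t 0 b)).
  by move=> /JE /xv[].
have cx t : J t -> {for t, continuous x}.
  by move=> Jt; apply/differentiable_continuous/derivable1_diffP; case: (dx t Jt).
have ib t : J t -> chart_dom i (beta t) /\ x t = chart i (beta t).
  by move=> /UJ[p [ip _] E]; rewrite /beta -E !chartK.
have cb t : J t -> {for t, continuous beta}.
  move=> Jt; apply: (@continuous_comp _ _ _ x (chart_inv i)); first exact: cx.
  by apply: chart_inv_continuous; have [p [ip _] E] := UJ t Jt; exists p.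
have Ckx k a : Ck_curve k J (fun t => x t 0 a).
  apply: (second_order_ode_smooth oJ sG) => t Jt; split; [exact: UJ|exact: dx|exact: dv].
have near_dom j t : J t -> chart_dom j (beta t) ->
    \forall s \near t, J s /\ chart_dom j (beta s).
  move=> Jt jt; apply: filterI; first exact: open_nbhs_nbhs.
  exact: (curve_near_dom (chart_dom_open j) (cb t Jt) jt).
have sb : smooth_curve_on J beta.
  move=> t Jt; split; first exact: cb.
  move=> j jt a k.
  (* On these times the coordinates in [j] are the change of chart applied to [x], and smoothness
     carries over by composition. *)
  pose J' := [set s | J s /\ chart_dom j (beta s)].
  have oJ' : open J'.
    rewrite openE => s [Js js]; exact: near_dom.
  have J't : J' t by split.
  apply: Ck_curve_derivable J't => {}k.
  have CJ' b : Ck_curve k J' (fun s => x s 0 b) by apply: Ck_curve_subset (Ckx k b) => s [].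
  apply: (Ck_curve_comp oJ' (@transition_smooth _ _ N i j a) _ CJ').
  by move=> s [Js js]; have [is_ ->] := ib s Js; exists (beta s).
have velE t : J t -> velocity beta t = constant_field i (v t) (beta t).
  move=> Jt; have [ip xt] := ib t Jt; have jp := chart_at_dom (beta t).
  rewrite /velocity derive1E /constant_field /dtransition -xt.
  have dT : differentiable (chart (chart_at (beta t)) \o chart_inv i) (x t).
    by rewrite xt; exact: transition_differentiable.
  by have [_ E] := is_derive_comp_curve (dx t Jt) dT.
exists J, beta; split=> //.
- split=> //; first exact: interval_is_interval.
  move=> t Jt; have [ip xt] := ib t Jt; set p := beta t in ip xt *.
  have jp := chart_at_dom p; set j := chart_at p in jp *.
  have [a' da' accE] := chart_acceleration_transition hnabla ip jp xt (dx t Jt) (dv t Jt).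
  rewrite [RHS](_ : 0 = chart_acceleration nabla j p (dtransition i j p (v t)) a'); last first.
    by rewrite accE xt (chart_acceleration_christoffel hnabla).
  rewrite /covariant_deriv_along /chart_acceleration -/p -/j.
  have -> : derive1 (fun s => in_chart j (beta s) (velocity beta s)) t = a'.
    have [_ <-] := da'; rewrite derive1E; apply: near_eq_derive.
    apply: filterS (near_dom j t Jt jp) => s [Js js]; have [is_ xs] := ib s Js.
    rewrite (velE s Js) in_chartE (dtransition_comp _ is_ (chart_at_dom _) js).
    by rewrite /dtransition xs.
  have -> : constant_field j a' p = a' by rewrite /constant_field dtransition_id.
  have inE : in_chart j p (velocity beta t) = dtransition i j p (v t).
    rewrite (velE t Jt) in_chartE /constant_field dtransition_comp//.
  rewrite inE (velE t Jt) -(constant_field_transition (v t) ip jp).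
  reflexivity.
- by rewrite /beta x0 chartK.
- have b0 : beta 0 = q by rewrite /beta x0 chartK.
  by rewrite velE// v0' b0 /constant_field dtransition_id.
Qed.

End LocalGeodesics.

(** * The shape operators *)

Section Projection.
Variables (R : realType) (n : nat) (N : manifold R n) (g : riemannian_metric N).
Variable D : N -> {vspace 'rV[R]_n}.
Implicit Types (q : N) (v w y : 'rV[R]_n).

(** [tangential_part] is picked by [get], so its defining property is available only through this
    existence. *)
Lemma orthogonal_projection_exists q v :
  exists y, y \in D q /\ forall w, w \in D q -> g q (v - y) w = 0.
Proof.
set E := vbasis (D q); set r := \dim (D q).
have freeE : free E := basis_free (vbasisP (D q)).
pose G : 'M[R]_r := \matrix_(a, b) g q E`_a E`_b.
have span w : (forall b : 'I_r, g q w E`_b = 0) -> forall y, y \in D q -> g q w y = 0.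
  move=> wE y yD; rewrite (coord_vbasis yD) metric_sumr big1// => b _.
  by rewrite metricZr wE mulr0.
have combE (c : 'rV[R]_r) (b : 'I_r) : g q (\sum_a c 0 a *: E`_a) E`_b = (c *m G) 0 b.
  by rewrite metric_suml mxE; apply: eq_bigr => a _; rewrite metricZl mxE.
have combD (c : 'rV[R]_r) : \sum_a c 0 a *: E`_a \in D q.
  by apply: memv_suml => a _; apply: memvZ; apply: vbasis_mem; rewrite mem_nth// size_tuple.
(* A row vector killed by the Gram matrix gives a combination of the basis orthogonal to itself,
   hence zero, and freeness kills its coefficients. *)
have Gunit : G \in unitmx.
  rewrite -row_free_unit -kermx_eq0; apply/eqP/row_matrixP => k; rewrite row0.
  set c := row k (kermx G).
  have cG : c *m G = 0 by rewrite -row_mul mulmx_ker row0.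
  have : \sum_a c 0 a *: E`_a = 0.
    apply/eqP; rewrite -(metric_eq0 g q) (span _ _ _ (combD c))// => b.
    by rewrite combE cG mxE.
  by move/freeP: freeE => fE /(fE (fun a => c 0 a)) c0; apply/rowP => a; rewrite c0 mxE.
pose c : 'rV[R]_r := (\row_b g q v E`_b) *m invmx G.
exists (\sum_a c 0 a *: E`_a); split; first exact: combD.
apply: span => b; rewrite metricBl combE /c mulmxKV// mxE subrr//.
Qed.

Lemma tangential_partP q v : tangential_part g D q v \in D q /\
  forall w, w \in D q -> g q (v - tangential_part g D q v) w = 0.
Proof. exact: (getPex (orthogonal_projection_exists q v)). Qed.

Lemma tangential_part_unique q v y : y \in D q ->
  (forall w, w \in D q -> g q (v - y) w = 0) -> tangential_part g D q v = y.
Proof.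
move=> yD vy; have [tD vt] := tangential_partP q v.
apply/eqP; rewrite -subr_eq0 -(metric_eq0 g q); apply/eqP.
have dD : tangential_part g D q v - y \in D q by rewrite memvB.
set t := tangential_part g D q v in vt tD dD *.
have {1}-> : t - y = (v - y) - (v - t) by rewrite opprB [RHS]addrC addrA subrK.
by rewrite metricBl vy// vt// subrr.
Qed.

Lemma normal_part_orthogonal q v w : w \in D q -> g q (normal_part g D q v) w = 0.
Proof. by move=> wD; have [_ ->] := tangential_partP q v. Qed.

Lemma metric_normal_part q v w : (forall y, y \in D q -> g q w y = 0) ->
  g q (normal_part g D q v) w = g q v w.
Proof.
move=> wN; have [tD _] := tangential_partP q v.
by rewrite /normal_part metricBl [X in _ - X]Defs.metric_sym wN// subr0.
Qed.

Lemma normal_partE q t w : t \in D q -> (forall y, y \in D q -> g q w y = 0) ->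
  normal_part g D q (t + w) = w.
Proof.
move=> tD wN; rewrite /normal_part.
have -> : tangential_part g D q (t + w) = t; last by rewrite addrC addKr.
by apply: tangential_part_unique tD _ => y yD; rewrite addrC addKr; exact: wN.
Qed.

(** By orthogonality [g q w nw = g q nw nw], so the cosine of the angle is the ratio of the lengths
    of [nw] and [w]. Squaring removes both the roots and the sign of the sine. *)
Lemma metric_normal_part_sin q w : let nw := normal_part g D q w in
  g q nw nw = g q w w * (1 - sin (angle g q w nw) ^+ 2).
Proof.
move=> nw; have [tD _] := tangential_partP q w.
have wnw : g q w nw = g q nw nw.
  rewrite metric_normal_part// => y; exact: normal_part_orthogonal.
have ww : g q w w = g q nw nw + g q (w - nw) (w - nw).
  set T := tangential_part g D q w in tD; have wE : w = nw + T by rewrite subrK.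
  have nT : g q nw T = 0 by exact: normal_part_orthogonal.
  clearbody nw T; rewrite wE [nw + T - nw]addrC addKr metricDl !metricDr.
  by rewrite [g q T nw]Defs.metric_sym nT addr0 add0r addrC.
rewrite /angle wnw; set x := _ / _.
have nn0 : 0 <= g q nw nw by exact: metric_ge0.
have ww0 : 0 <= g q w w by exact: metric_ge0.
have x2 : g q w w * x ^+ 2 = g q nw nw.
  (* For [nw = 0] the quotient [x] is 0 even when [w = 0], matching the convention of a right
     angle. *)
  have [nw0|nwn0] := eqVneq nw 0.
    by rewrite /x nw0 !metric0l mul0r expr0n mulr0.
  have nwp : 0 < g q nw nw by exact: metric_pos.
  have wp : 0 < g q w w by rewrite ww ltr_wpDr// metric_ge0.
  rewrite /x expr_div_n exprMn !sqr_sqrtr//.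
  by field; rewrite !gt_eqF.
have x1 : -1 <= x <= 1.
  rewrite -ler_norml -(@expr_le1 _ 2)//  real_normK ?num_real//.
  have [ww00|wn0] := eqVneq (g q w w) 0.
    move/eqP: ww00; rewrite metric_eq0 => /eqP w0; rewrite /x -wnw w0 metric0l mul0r expr0n.
    exact: ler01.
  have wp : 0 < g q w w by rewrite lt_def wn0.
  rewrite -(ler_pM2l wp) x2 mulr1 ww lerDl; exact: metric_ge0.
rewrite sin_acos// sqr_sqrtr; first by rewrite subKr x2.
move: x1; rewrite -ler_norml -(@expr_le1 _ 2)// real_normK ?num_real// => x1.
by rewrite subr_ge0.
Qed.

End Projection.

(** * Clairaut's relation to first order *)

Section ClairautRelation.
Variables (R : realType) (n : nat) (N : manifold R n) (g : riemannian_metric N).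
Variables (nabla : N -> 'rV[R]_n -> (N -> 'rV[R]_n) -> 'rV[R]_n) (D : N -> {vspace 'rV[R]_n}).
Hypothesis hnabla : levi_civita g nabla.
Variable f : N -> R.
Hypothesis hf : smooth_fun_on setT f.
Hypothesis clairaut : forall (J : set R) (beta : R -> N), geodesic_on nabla J beta ->
   let theta t := angle g (beta t) (velocity beta t)
                    (normal_part g D (beta t) (velocity beta t)) in
   forall t1 t2, J t1 -> J t2 ->
     expR (f (beta t1)) * sin (theta t1) = expR (f (beta t2)) * sin (theta t2).

Lemma normal_section_near V q : normal_section g D V -> smooth_field_near q V.
Proof. by move=> [sV _]; exists setT; split=> //; exact: openT. Qed.

(* Along the geodesic with initial velocity [T + V q], Clairaut's relation makes the squared
   length of the normal part of the velocity [w] a smooth function of time, which dominates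
   [2 * g w V - g V V] with equality at time [0]; hence both have the same derivative there. *)
Lemma clairaut_derivative V q T : normal_section g D V -> T \in D q ->
  g q T T * deriv_along q (T + V q) f = g q T (nabla q (T + V q) V).
Proof.
move=> nV TD; have sV p := normal_section_near p nV; have [_ VD] := nV.
have sf p : smooth_fun_near p f by exists setT; split=> //; exact: openT.
have [J [beta [geo J0 b0 v0]]] := geodesic_exists hnabla q (T + V q).
have [_ oJ sb _] := geo.
pose vel t := velocity beta t.
pose theta t := angle g (beta t) (vel t) (normal_part g D (beta t) (vel t)).
pose C := expR (f q) * sin (theta 0).
(* Clairaut's relation solved for the sine: equal to [sin (theta t)] on [J], but differentiable by
   construction. *)
pose B t := C * expR (- f (beta t)).
pose A t := g (beta t) (vel t) (vel t).
have sinE t : J t -> sin (theta t) = B t.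
  move=> Jt; have := clairaut geo Jt J0; rewrite -/(theta t) -/(theta 0) b0 -/C => E.
  by rewrite /B -E expRN mulrC mulKf// gt_eqF// expR_gt0.
have normalE t : J t -> g (beta t) (normal_part g D (beta t) (vel t))
    (normal_part g D (beta t) (vel t)) = A t * (1 - B t ^+ 2).
  by move=> Jt; rewrite metric_normal_part_sin -/(theta t) sinE.
pose h t := A t * (1 - B t ^+ 2) - 2 * g (beta t) (vel t) (V (beta t))
  + g (beta t) (V (beta t)) (V (beta t)).
have h_ge0 t : J t -> 0 <= h t.
  move=> Jt; rewrite /h -normalE//; set nw := normal_part _ _ _ _.
  have E : g (beta t) (vel t) (V (beta t)) = g (beta t) nw (V (beta t)).
    by rewrite metric_normal_part// => y; exact: VD.
  clearbody nw.
  have -> : g (beta t) nw nw - 2 * g (beta t) (vel t) (V (beta t)) +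
      g (beta t) (V (beta t)) (V (beta t)) = g (beta t) (nw - V (beta t)) (nw - V (beta t)).
    by rewrite E metricBl !metricBr (Defs.metric_sym g _ (V (beta t)) nw); ring.
  exact: metric_ge0.
have nv0 : normal_part g D q (T + V q) = V q by apply: normal_partE => // y; exact: VD.
have AB0 : A 0 * B 0 ^+ 2 = g q T T.
  have := normalE 0 J0; rewrite /A /vel b0 v0 nv0.
  rewrite metricDl !metricDr [g q T (V q)]Defs.metric_sym (VD q T TD).
  by move: (g q T T) (g q (V q) (V q)) (B 0 ^+ 2) => a b c; lra.
have h0 : h 0 = 0.
  rewrite /h -normalE// /vel b0 v0 nv0 metricDl [g q T (V q)]Defs.metric_sym (VD q T TD).
  by ring.
pose df t := deriv_along (beta t) (vel t) f.
have hd t : J t -> is_derive t 1 h (A t * (2 * B t ^+ 2 * df t)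
   - 2 * g (beta t) (vel t) (nabla (beta t) (vel t) V)
   + 2 * g (beta t) (V (beta t)) (nabla (beta t) (vel t) V)).
  move=> Jt.
  have dA : is_derive t 1 A 0 by exact: (derive_speed hnabla geo Jt).
  have dF : is_derive t 1 (f \o beta) (df t) by exact: (smooth_curve_comp sb Jt (sf _)).
  have dE : is_derive t 1 (expR \o (- (f \o beta))) (expR (- f (beta t)) * - df t).
    by apply: is_derive1_comp; exact: is_deriveN.
  have dB : is_derive t 1 B (- (df t * B t)).
    have := is_deriveZ C dE; rewrite (_ : C \*: _ = B)// => H.
    by apply: is_derive_eq H _; rewrite /B /GRing.scale/=; ring.
  have dV := derive_metric_velocity hnabla geo Jt (sV (beta t)).
  have dVV : is_derive t 1 (fun s => g (beta s) (V (beta s)) (V (beta s)))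
      (2 * g (beta t) (V (beta t)) (nabla (beta t) (vel t) V)).
    have := smooth_curve_comp sb Jt (smooth_metric_near g (sV _) (sV _)).
    rewrite (nabla_metric hnabla _ (sV _) (sV _)) [X in X + _]Defs.metric_sym.
    by move=> H; apply: is_derive_eq H _; ring.
  have dh := is_deriveD (is_deriveB (is_deriveM dA
    (is_deriveB (is_derive_cst (1 : R) t 1) (is_deriveM dB dB))) (is_deriveZ 2 dV)) dVV.
  have hE : h = A * (cst 1 - B * B) - 2 \*: (fun s => g (beta s) (vel s) (V (beta s)))
      + (fun s => g (beta s) (V (beta s)) (V (beta s))).
    by apply/funext => s; rewrite /h expr2.
  rewrite hE; apply: is_derive_eq dh _; rewrite /GRing.scale/=; ring.
have [e e0 eJ] := (nbhs_ballP _ _).1 (open_nbhs_nbhs (conj oJ J0)).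
have inJ t : t \in `]- e, e[ -> J t.
  by rewrite in_itv/= => te; apply: eJ; rewrite /= -ball_normE/= sub0r normrN ltr_norml.
have ee : - e <= e by rewrite /= in e0; lra.
(* [h] is nonnegative on the interval and vanishes at time 0, an interior minimum. *)
have [_ hd0] : is_derive (0 : R) 1 h 0.
  apply: (derive1_at_min ee).
  - by move=> t /inJ Jt; have [] := hd t Jt.
  - by rewrite in_itv/= oppr_lt0; apply/andP.
  - by move=> t /inJ Jt; rewrite h0; exact: h_ge0.
have [_ hd0'] := hd 0 J0.
(* The two connection terms have first arguments [T + V q] and [V q]; their difference leaves only
   [T]. *)
move: hd0; rewrite hd0' /df /vel b0 v0 => E.
have {}E : A 0 * B 0 ^+ 2 * deriv_along q (T + V q) f =
    g q (T + V q) (nabla q (T + V q) V) - g q (V q) (nabla q (T + V q) V) by lra.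
by rewrite -AB0 E metricDl addrK.
Qed.

End ClairautRelation.

(** * Symmetry of the second fundamental form over the image of [F] *)

Section Symmetry.
Variables (R : realType) (m n : nat) (M : manifold R m) (N : manifold R n).
Variables (g : riemannian_metric N).
Variables (nabla : N -> 'rV[R]_n -> (N -> 'rV[R]_n) -> 'rV[R]_n).
Hypothesis hnabla : levi_civita g nabla.

Lemma derive_constant_field_in_chart (j : chart_index N) q (v w : 'rV[R]_n) :
  chart_dom j q -> 'D_v (field_in_chart j (constant_field j w)) (chart j q) = 0.
Proof.
move=> jq; transitivity ('D_v (cst w) (chart j q)); last exact: derive_cst.
apply: near_eq_derive; have := chart_image_nbhs openT jq I.
apply: filterS => _ [q' [jq' _] <-].
by rewrite /field_in_chart chartK// in_chart_constant_field.
Qed.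

(** Coordinate fields commute, so torsion-freeness makes the Christoffel symbols symmetric; this is
    the bilinear form of that fact. *)
Lemma nabla_coord_field_sym q (v w : 'rV[R]_n) (j := chart_at q) :
  \sum_a w 0 a *: nabla q (constant_field j v q) (coord_field j a) =
  \sum_a v 0 a *: nabla q (constant_field j w q) (coord_field j a).
Proof.
have jq : chart_dom j q := chart_at_dom q.
have near_j a := coord_field_near a jq.
have sym a b : nabla q (coord_field j a q) (coord_field j b) =
    nabla q (coord_field j b q) (coord_field j a).
  apply/eqP; rewrite -subr_eq0 (nabla_torsion_free hnabla (near_j a) (near_j b)).
  have Z a' v' : 'D_v' (field_in_chart j (coord_field j a')) (chart j q) = 0.
    exact: derive_constant_field_in_chart.
  apply/eqP; rewrite -[RHS](subrr 0).
  exact: (congr2 (fun v' w' => v' - w') (Z b _) (Z a _)).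
have expand (v' w' : 'rV[R]_n) : \sum_a w' 0 a *: nabla q (constant_field j v' q) (coord_field j a)
    = \sum_a \sum_b (w' 0 a * v' 0 b) *: nabla q (coord_field j b q) (coord_field j a).
  apply: eq_bigr => a _; rewrite (constant_field_sum v' jq) (nabla_suml hnabla _ (near_j a)).
  rewrite scaler_sumr; apply: eq_bigr => b _.
  by rewrite (nablaZl hnabla _ _ (near_j a)) scalerA.
rewrite !expand exchange_big; apply: eq_bigr => b _; apply: eq_bigr => a _.
by rewrite mulrC sym.
Qed.

Variable F : M -> N.
Hypothesis hF : smooth_map F.

(** [differential F p] is expressed in charts chosen at [p] and at [F p], which may jump as [p]
    moves. Differentiating in [p] requires this expression in fixed charts. *)
Lemma differential_in_chart (i : chart_index M) (j : chart_index N) p (u : 'rV[R]_m) :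
  chart_dom i p -> chart_dom j (F p) ->
  constant_field j ('D_u (chart j \o F \o chart_inv i) (chart i p)) (F p) =
  differential F p (constant_field i u p).
Proof.
move=> ip jp; have ap := chart_at_dom p; have aFp := chart_at_dom (F p).
have [cF sF] := hF.
have dphi (i' : chart_index M) (j' : chart_index N) : chart_dom i' p -> chart_dom j' (F p) ->
    differentiable (chart j' \o F \o chart_inv i') (chart i' p).
  by move=> ip' jp'; apply: smooth_vec_on_differentiable (sF i' j') _; exact: chart_image_chart.
have Ei : (chart (chart_at p) \o chart_inv i) (chart i p) = chart (chart_at p) p.
  by rewrite /= chartK.
have Ej : (chart j \o F \o chart_inv i) (chart i p) = chart j (F p) by rewrite /= chartK.
rewrite /differential /constant_field /dtransition.
rewrite -[in RHS]Ei -derive_comp ?Ei; last 2 first.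
- exact: transition_differentiable.
- exact: dphi.
rewrite -[in LHS]Ej -derive_comp ?Ej; last 2 first.
- exact: dphi.
- exact: transition_differentiable.
apply: near_eq_derive.
have oF : open (F @^-1` chart_dom j).
  by apply: open_comp (chart_dom_open j) => ? _; exact: cF.
have H1 := chart_image_nbhs oF ip jp.
have H2 := chart_image_nbhs (chart_dom_open (chart_at p)) ip ap.
apply: filterS2 H1 H2 => _ [p' [ip' jp'] <-] [p'' [ip'' ap''] E] /=.
have pp : p'' = p' by rewrite -(chartK ip') -(chartK ip'') E.
by rewrite !chartK// -pp.
Qed.

Variable V : N -> 'rV[R]_n.
Hypothesis sV : forall q, smooth_field_near q V.
Hypothesis V_normal : forall p v, g (F p) (V (F p)) (differential F p v) = 0.

(* The 1-form [g V _] pulls back to zero under [F], and so does its exterior derivative. *)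
Lemma second_fundamental_form_sym p u u' :
  g (F p) (nabla (F p) (differential F p u) V) (differential F p u') =
  g (F p) (nabla (F p) (differential F p u') V) (differential F p u).
Proof.
have [cF sF] := hF.
set q := F p; set i := chart_at p; set j := chart_at q.
have ip : chart_dom i p := chart_at_dom p.
have jq : chart_dom j q := chart_at_dom q.
pose phi := chart j \o F \o chart_inv i.
pose W := chart_image i (F @^-1` chart_dom j).
have oF : open (F @^-1` chart_dom j).
  by apply: open_comp (chart_dom_open j) => ? _; exact: cF.
have oW : open W by exact: chart_image_open.
have sphi : smooth_vec_on W phi by exact: sF.
have Wp : W (chart i p) by exact: chart_image_chart.
have phip : phi (chart i p) = chart j q by rewrite /phi /= chartK.
have dphi : differentiable phi (chart i p) by exact: smooth_vec_on_differentiable Wp.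
pose th a q' := g q' (V q') (coord_field j a q').
have sth a : smooth_fun_near q (th a).
  by exact: (smooth_metric_near _ (sV q) (coord_field_near a jq)).
have dth a : differentiable (th a \o chart_inv j) (phi (chart i p)).
  by rewrite phip; exact: smooth_fun_near_differentiable.
pose d w := 'D_w phi (chart i p).
have dE w : d w = differential F p w by [].
(* The pulled-back form, evaluated on a field constant in the chart [i], vanishes on a whole open
   set, so it may be differentiated. *)
have zero w x : W x -> \sum_a (th a \o chart_inv j) (phi x) * 'D_w (fun y => phi y 0 a) x = 0.
  move=> [p' [ip' jp'] <-].
  have := V_normal p' (constant_field i w p').
  rewrite -(differential_in_chart w ip' jp') (constant_field_sum _ jp') metric_sumr => E.
  rewrite -[RHS]E; apply: eq_bigr => a _; rewrite metricZr mulrC.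
  rewrite /phi /= !chartK// -derive_rV//.
  by apply: smooth_vec_on_differentiable sphi _; exists p'.
(* [P] and [Q] are the Leibniz terms of the derivative of [zero] along [w']: the former carries the
   second derivatives of [phi], the latter the derivatives of the form. *)
pose P w w' := \sum_a (th a \o chart_inv j) (phi (chart i p)) *
      'D_w' (fun x => 'D_w (fun y => phi y 0 a) x) (chart i p).
pose Q w w' := \sum_a 'D_w (fun y => phi y 0 a) (chart i p) *
      'D_(d w') (th a \o chart_inv j) (chart j q).
have key w w' : P w w' + Q w w' = 0.
  rewrite -big_split; transitivity (\sum_a ((th a \o chart_inv j) (phi (chart i p)) *
      'D_w' (fun x => 'D_w (fun y => phi y 0 a) x) (chart i p) +
    'D_w (fun y => phi y 0 a) (chart i p) * 'D_(d w') (th a \o chart_inv j) (chart j q))); first by [].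
  pose h := \sum_a ((th a \o chart_inv j \o phi) * (fun x => 'D_w (fun y => phi y 0 a) x)).
  have h0 : 'D_w' h (chart i p) = 0.
    transitivity ('D_w' (cst (0 : R)) (chart i p)); last exact: derive_cst.
    apply: near_eq_derive; apply: filterS (open_nbhs_nbhs (conj oW Wp)) => x Wx.
    by rewrite /h fct_sumE; exact: zero.
  have d1 a : derivable (th a \o chart_inv j \o phi) (chart i p) w'.
    exact: diff_derivable (differentiable_comp dphi (dth a)).
  have d2 a : derivable (fun x => 'D_w (fun y => phi y 0 a) x) (chart i p) w'.
    apply: diff_derivable; apply: smooth_on_differentiable Wp.
    exact: smooth_on_derive oW (sphi a).
  rewrite -[RHS]h0 derive_sum; last by move=> a; exact: derivableM (d1 a) (d2 a).
  apply: eq_bigr => a _; rewrite (deriveM (d1 a) (d2 a)) (derive_comp w' dphi (dth a)).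
  by rewrite {2}phip.
have Dth a w : 'D_(d w) (th a \o chart_inv j) (chart j q) =
    g q (nabla q (d w) V) (coord_field j a q) + g q (V q) (nabla q (d w) (coord_field j a)).
  by rewrite -(nabla_metric hnabla (d w) (sV q) (coord_field_near a jq)).
have comp w w' : Q w w' =
    g q (nabla q (d w') V) (d w) + g q (V q) (\sum_a d w 0 a *: nabla q (d w') (coord_field j a)).
  have -> : g q (nabla q (d w') V) (d w) =
      \sum_a d w 0 a * g q (nabla q (d w') V) (coord_field j a q).
    have {1}-> : d w = \sum_a d w 0 a *: coord_field j a q.
      by rewrite -(constant_field_sum _ jq) /constant_field dtransition_id.
    by rewrite metric_sumr; apply: eq_bigr => a _; rewrite metricZr.
  rewrite metric_sumr -big_split; apply: eq_bigr => a _.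
  by rewrite Dth metricZr -derive_rV// mulrDr.
have constE w : constant_field j w q = w by rewrite /constant_field dtransition_id.
have sym := nabla_coord_field_sym q (d u) (d u').
cbv zeta in sym; rewrite -/j (constE (d u)) (constE (d u')) in sym.
have swap : P u u' = P u' u.
  by apply: eq_bigr => a _; rewrite (derive_swap u u' oW (sphi a) Wp).
clearbody P Q.
(* [P] is symmetric by Schwarz and [P + Q] vanishes. In [Q], the part containing derivatives of
   coordinate fields is symmetric by [sym], which leaves the claim. *)
have QE : Q u u' = Q u' u.
  by apply: (addrI (P u u')); apply: etrans (key u u') _; rewrite swap key.
have E := etrans (esym (comp u u')) (etrans QE (comp u' u)).
have E' := etrans E (congr1 (fun z => g q (nabla q (d u) V) (d u') + g q (V q) z) sym).
exact: esym (addIr _ E').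
Qed.

End Symmetry.

(** * Umbilicity at a point *)

Section ShapeOperator.
Variables (R : realType) (n : nat) (N : manifold R n) (g : riemannian_metric N).
Variables (nabla : N -> 'rV[R]_n -> (N -> 'rV[R]_n) -> 'rV[R]_n) (D : N -> {vspace 'rV[R]_n}).
Hypothesis hnabla : levi_civita g nabla.
Variables (f : N -> R) (V : N -> 'rV[R]_n) (q : N).
Hypothesis hf : smooth_fun_on setT f.
Hypothesis hclairaut : forall (J : set R) (beta : R -> N), geodesic_on nabla J beta ->
   let theta t := angle g (beta t) (velocity beta t)
                    (normal_part g D (beta t) (velocity beta t)) in
   forall t1 t2, J t1 -> J t2 ->
     expR (f (beta t1)) * sin (theta t1) = expR (f (beta t2)) * sin (theta t2).
Hypothesis hgeod : normal_totally_geodesic g nabla D.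
Hypothesis hV : normal_section g D V.
(** Stated at the single point [q]: symmetry is supplied only where [D q] is the range of a
    differential of [F]. *)
Hypothesis hsym : forall T T', T \in D q -> T' \in D q ->
  g q (nabla q T V) T' = g q (nabla q T' V) T.

Lemma clairaut_quadratic T : T \in D q ->
  g q (nabla q T V) T = deriv_along q (V q) f * g q T T.
Proof.
move=> TD; have NTD : - T \in D q by rewrite memvN.
have sV : smooth_field_near q V by exact: normal_section_near hV.
have VV0 T' : T' \in D q -> g q T' (nabla q (V q) V) = 0.
  by move=> T'D; rewrite Defs.metric_sym; have [_ ->] := hgeod hV hV.
have dfD v w : deriv_along q (v + w) f = deriv_along q v f + deriv_along q w f.
  have sf : smooth_fun_near q f by exists setT; split=> //; exact: openT.
  have df := smooth_fun_near_differentiable (chart_at_dom q) sf.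
  by rewrite /deriv_along -[v in v + w]scale1r derive_linear// scale1r.
have E1 := clairaut_derivative hnabla hf hclairaut hV TD.
have E2 := clairaut_derivative hnabla hf hclairaut hV NTD.
move: E1 E2; rewrite !dfD !(nablaDl hnabla _ _ sV) !metricDr !VV0// !addr0.
rewrite -scaleN1r (nablaZl hnabla _ _ sV) !metricZl !metricZr.
have -> : deriv_along q (-1 *: T) f = - deriv_along q T f.
  have := dfD (-1 *: T) T; rewrite scaleN1r addNr.
  have -> : deriv_along q 0 f = 0 by exact: derive0.
  by move=> /esym/eqP; rewrite addr_eq0 => /eqP.
rewrite (Defs.metric_sym g q T (nabla q T V)).
move: (g q _ T) (g q T T) (deriv_along q T f) (deriv_along q (V q) f) => b c d e E1 E2.
by lra.
Qed.

Lemma shape_operator_umbilical T : T \in D q ->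
  shape_operator g nabla D V q T = - deriv_along q (V q) f *: T.
Proof.
move=> TD; rewrite /shape_operator scaleNr; congr (- _).
apply: tangential_part_unique => [|w wD]; first exact: memvZ.
have sV : smooth_field_near q V by exact: normal_section_near hV.
have := clairaut_quadratic (memvD TD wD).
rewrite (nablaDl hnabla _ _ sV) !(metricDl, metricDr) !clairaut_quadratic//.
rewrite (hsym wD TD) (Defs.metric_sym g q w T) metricNl metricZl.
move: (g q (nabla q T V) w) (g q T T) (g q w w) (g q T w) (deriv_along q (V q) f).
move=> a b c d e E; lra.
Qed.

End ShapeOperator.

Theorem theorem2 (R : realType) (m n : nat)
    (M : manifold R m) (N : manifold R n)
    (gM : riemannian_metric M) (gN : riemannian_metric N)
    (nablaN : N -> 'rV[R]_n -> (N -> 'rV[R]_n) -> 'rV[R]_n)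
    (F : M -> N) (D : N -> {vspace 'rV[R]_n}) (f : N -> R)
    (hnabla : levi_civita gN nablaN)
    (hF : smooth_map F)
    (hrank : forall p : M, (0 < rank_at F p < minn m n)%N)
    (hD : range_distribution F D)
    (hf : smooth_fun_on setT f)
    (hclairaut : clairaut_riemannian_map gM gN F nablaN D
                   (fun q => expR (f q)))
    (hgeod : normal_totally_geodesic gN nablaN D)
    (X : M -> 'rV[R]_m) (hX : horizontal_section gM F X)
    (V W : N -> 'rV[R]_n)
    (hV : normal_section gN D V) (hW : normal_section gN D W) :
  forall p : M,
    shape_commutator gN nablaN D W V (F p) (differential F p (X p)) = 0.
Proof.
move=> p; have [_ _ clairaut] := hclairaut; have [_ rangeD] := hD.
have sym Y : normal_section gN D Y -> forall T T', T \in D (F p) -> T' \in D (F p) ->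
    gN (F p) (nablaN (F p) T Y) T' = gN (F p) (nablaN (F p) T' Y) T.
  move=> hY T T' /rangeD[u ->] /rangeD[u' ->].
  apply: (second_fundamental_form_sym hnabla hF).
    by move=> q; exact: normal_section_near hY.
  by move=> p' v; have [_] := hY; apply; apply/rangeD; exists v.
have SE Y T : normal_section gN D Y -> T \in D (F p) ->
    shape_operator gN nablaN D Y (F p) T = - deriv_along (F p) (Y (F p)) f *: T.
  by move=> hY; exact: (shape_operator_umbilical hnabla hf clairaut hgeod hY (sym Y hY)).
have TD : differential F p (X p) \in D (F p) by apply/rangeD; exists (X p).
(* The inner shape operators return multiples of the given vector, which stay in [D (F p)], so the
   scalar formula applies a second time. *)
rewrite /shape_commutator (SE V _ hV TD) (SE W _ hW TD).
rewrite (SE W _ hW (memvZ _ TD)) (SE V _ hV (memvZ _ TD)).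
by rewrite !scalerA mulrC subrr.
Qed.
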